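(* Every spherical subword complex $\mathcal{S}(Q,\pi)$ of finite type is strongly vertex decomposable, and hence strongly shellable.
   Context: A simplicial complex $\Delta$ on a finite set $V$ is a set of subsets of $V$ (faces) closed under taking subsets; facets are the inclusion-maximal faces; $v$ is a vertex if $\{v\}\in\Delta$; $\dim I=|I|-1$; $\Delta$ is pure if all facets have the same dimension. For a face $I$ define $\operatorname{del}_\Delta(I)=\{J\in\Delta: I\not\subseteq J\}$, $\operatorname{star}_\Delta(I)=\{J\in\Delta: I\cup J\in\Delta\}$, $\operatorname{link}_\Delta(I)=\{J\in\Delta: I\cup J\in\Delta,\ I\cap J=\emptyset\}$, and $\operatorname{costar}_\Delta(I)=\{J\in\Delta:\ J\subseteq F \text{ for some facet } F \text{ of } \Delta \text{ with } I\not\subseteq F\}$. $\Delta$ is vertex decomposable if it is a simplex, or it is pure and has a vertex $v$ such that both $\operatorname{del}_\Delta(\{v\})$ and $\operatorname{link}_\Delta(\{v\})$ are vertex decomposable. $\Delta$ is shellable if it is a simplex, or it is pure and has a facet $F$ such that $\operatorname{costar}_\Delta(F)$ is shellable and $2^F\cap\operatorname{costar}_\Delta(F)$ is pure of dimension $\dim\Delta-1$. A simplex is the complex $2^F$ of all subsets of a finite set $F$ (including $\{\emptyset\}$); by convention the complex with no faces at all is also regarded as a simplex. $\Delta$ is strongly vertex decomposable (resp. strongly shellable) if for every face $I\in\Delta$ both $\operatorname{costar}_\Delta(I)$ and $\operatorname{star}_\Delta(I)$ are vertex decomposable (resp. shellable). Let $(W,S)$ be a Coxeter system with $S$ finite and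 length function $\ell$. For a word $Q=(q_1,\dots,q_r)$ in $S$ and $J\subseteq[r]=\{1,\dots,r\}$, $Q_J$ denotes the subword of letters in positions in $J$. For $\pi\in W$, the subword complex $\mathcal{S}(Q,\pi)$ is the simplicial complex on $[r]$ whose facets are the subsets $I\subseteq[r]$ such that $Q_{[r]\setminus I}$ is a reduced expression for $\pi$. It is of finite type if $W$ is finite. It is spherical if its geometric realization is homeomorphic to a sphere (the complex $\{\emptyset\}$ counts as the $(-1)$-dimensional sphere); for a non-empty subword complex this is equivalent to $\operatorname{Dem}(Q)=\pi$, where the Demazure product is defined by $\operatorname{Dem}(\text{empty word})=e$ and, for $Q'$ obtained from $Q$ by appending $s\in S$, with $\mu=\operatorname{Dem}(Q)$: $\operatorname{Dem}(Q')=\mu s$ if $\ell(\mu s)>\ell(\mu)$ and $\operatorname{Dem}(Q')=\mu$ if $\ell(\mu s)<\ell(\mu)$. *)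

(* Defs.v *)
From mathcomp Require Import all_boot all_order all_algebra all_fingroup.
From mathcomp Require Import all_classical all_reals all_analysis.

Set Implicit Arguments.
Unset Strict Implicit.
Unset Printing Implicit Defensive.

Import Order.TTheory GRing.Theory Num.Theory numFieldNormedType.Exports.

(** A complex on a finite type [V] is the set of its faces.  The void complex
    [set0] is allowed and is distinct from [[set set0]], whose only face is
    the empty one. *)
Section Complexes.
Local Open Scope set_scope.
Variable V : finType.
Implicit Types (D : {set {set V}}) (I J F : {set V}).

Definition facet D F : bool := maxset [pred G : {set V} | G \in D] F.

Definition face_dim I : int := (#|I|%:Z - 1)%R.

(** The void complex gets dimension -1.  This does not affect [shellable]:
    if [costar D F] is void for a facet [F], then [D] is the simplex on [F]. *)
Definition complex_dim D : int := ((\max_(F in D) #|F|)%:Z - 1)%R.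

Definition pure D : Prop :=
  forall F G, facet D F -> facet D G -> face_dim F = face_dim G.

Definition is_simplex D : Prop := D = finset.set0 \/ exists F, D = powerset F.

Definition del D I : {set {set V}} := [set J in D | ~~ (I \subset J)].

Definition star D I : {set {set V}} := [set J in D | I :|: J \in D].

Definition link D I : {set {set V}} :=
  [set J in D | (I :|: J \in D) && (I :&: J == finset.set0)].

Definition costar D I : {set {set V}} :=
  [set J in D | [exists F, [&& facet D F, ~~ (I \subset F) & J \subset F]]].

Inductive vertex_decomposable : {set {set V}} -> Prop :=
| VD_simplex D : is_simplex D -> vertex_decomposable D
| VD_vertex D (v : V) :
    pure D -> [set v] \in D ->
    vertex_decomposable (del D [set v]) ->
    vertex_decomposable (link D [set v]) ->
    vertex_decomposable D.

Inductive shellable : {set {set V}} -> Prop :=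
| Sh_simplex D : is_simplex D -> shellable D
| Sh_facet D F :
    pure D -> facet D F ->
    shellable (costar D F) ->
    pure (powerset F :&: costar D F) ->
    complex_dim (powerset F :&: costar D F) = (complex_dim D - 1)%R ->
    shellable D.

Definition strongly_vertex_decomposable D : Prop :=
  forall I, I \in D ->
    vertex_decomposable (costar D I) /\ vertex_decomposable (star D I).

Definition strongly_shellable D : Prop :=
  forall I, I \in D -> shellable (costar D I) /\ shellable (star D I).

End Complexes.

Section Coxeter.
Local Open Scope group_scope.
Variable W : finGroupType.
Implicit Types (S : {set W}) (q : seq W) (w : W).

(** [W] is presented by the generators [S] and the relations
    [(s * t) ^+ #[s * t] = 1]; being presented is expressed by the universal
    property against all groups [H], finite or not.  All the orders
    [#[s * t]] are finite because [W] is. *)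
Definition coxeter_system S : Prop :=
  [/\ forall s, s \in S -> #[s] = 2%N,
      <<S>> = [set: W]%SET
    & forall (H : groupType) (f : W -> H),
        (forall s t, s \in S -> t \in S -> (f s * f t) ^+ #[s * t] = 1) ->
        exists g : {multiplicative W -> H}, forall s, s \in S -> g s = f s].

Definition word_in S q : bool := all [in S] q.

Definition word_prod q : W := \prod_(x <- q) x.

(** [q] is a word in [S] with product [w], and no word in [S] that is strictly
    shorter has product [w]; that is, [size q] is the length of [w]. *)
Definition reduced_expression S q w : bool :=
  [&& word_in S q, word_prod q == w
    & ~~ [exists k : 'I_(size q), exists u : k.-tuple W,
            word_in S u && (word_prod u == w)]].

Definition subword r (Q : r.-tuple W) (J : {set 'I_r}) : seq W :=
  [seq tnth Q i | i <- enum J].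

Definition subword_complex S r (Q : r.-tuple W) (w : W) : {set {set 'I_r}} :=
  [set I : {set 'I_r} | [exists F : {set 'I_r},
     (I \subset F) && reduced_expression S (subword Q (~: F)) w]]%SET.

End Coxeter.

Section Spherical.
Local Open Scope classical_set_scope.
Local Open Scope ring_scope.
Variable R : realType.

Definition realization r (D : {set {set 'I_r}}) : set 'rV[R]_r :=
  [set x : 'rV[R]_r | [/\ forall i, 0 <= x ord0 i, \sum_i x ord0 i = 1
             & [set i | x ord0 i != 0]%SET \in D]].

(** The sphere of dimension [n - 1]; it is empty for [n = 0]. *)
Definition unit_sphere n : set 'rV[R]_n :=
  [set x : 'rV[R]_n | \sum_i x ord0 i ^+ 2 = 1].

Definition homeomorphic (T U : topologicalType) (A : set T) (B : set U) :=
  exists (f : T -> U) (g : U -> T),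
    [/\ {within A, continuous f}, {within B, continuous g},
        forall x, A x -> B (f x) /\ g (f x) = x
      & forall y, B y -> A (g y) /\ f (g y) = y].

(** [[set set0]] has empty realization and so is the sphere of dimension -1.
    The void complex also satisfies this predicate; having no face, it is
    strongly vertex decomposable and strongly shellable for trivial reasons. *)
Definition spherical r (D : {set {set 'I_r}}) : Prop :=
  exists n, homeomorphic (realization D) (@unit_sphere n).

End Spherical.

(* Main.v *)
Require Import Defs.
From mathcomp Require Import all_boot all_order all_algebra all_fingroup.
From mathcomp Require Import all_classical all_reals all_analysis.
From mathcomp Require Import zify ring lra.

Set Implicit Arguments.
Unset Strict Implicit.
Unset Printing Implicit Defensive.

Import Order.TTheory GRing.Theory Num.Theory numFieldNormedType.Exports.

(** A face of [subword_complex S Q w] is a set of positions of [Q] outside of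
    which a reduced word for [w] can still be read.  If the last letter [s] is a
    descent of [w], its position [v] has as link the complex of the shorter word
    for [w], and as deletion the one for [w * s], by the exchange condition; if
    [s] is an ascent, the complex is a cone over [v].  Hence all subword
    complexes are vertex decomposable ([cplx_vd]), and so are the stars, which
    are joins of a simplex with a subword complex ([star_cplx_vd]).

    Costars need sphericity.  For the longest element [w0] a first letter [s]
    can be moved to the end of the word as [s ^ w0], so any vertex [v] of a face
    [I] may be assumed to be the last letter.  The deletion of [v] from the
    costar of [I] is then the full deletion of [v], since facets without [v] do
    not contain [I], and the link of [v] is a costar in a shorter word
    ([costar_w0_vd]).  A word [Q] with Demazure product [w] reduces to this case
    by appending a reduced word for [w^-1 * w0]: the new letters are vertices of
    no face, because without one of them the length of [w0] is out of reach
    ([costar_dem_vd]).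

    It remains to see that the Demazure product of [Q] is [w] when the complex
    has a face and its realization is a sphere.  Otherwise the recursion on the
    last letter shows that the full simplex on the positions collapses onto the
    complex ([cplx_collapses]).  Collapses are retractions, so Brouwer's fixed
    point theorem for the simplex ([brouwer_simplex]) passes to the realization
    ([collapses_fixed_point]); but the antipodal map of a sphere has no fixed
    point ([spherical_no_fixed_point]).

    The exchange condition comes from the presentation of [W] by its action on
    signed reflections ([exchange_left]).  Brouwer's theorem is obtained from a
    parity argument for finite sets with several linear orders ([scarf]), which
    replaces triangulations by the grid points of the simplex.  Shellability
    follows from vertex decomposability ([vd_shellable]): facets containing the
    vertex are added after the facets of its deletion. *)

(** * Coxeter groups: exchange, Demazure products, the longest element *)

Section Coxeter.
Local Open Scope group_scope.
Variables (W : finGroupType) (S : {set W}).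
Hypothesis hS : coxeter_system S.
Implicit Types (u v q : seq W) (s t w x y : W).

(** Products in [W] are written here with one fixed structure, as in the
    lengths that arithmetic has to compare. *)
Fact mulWA x y t : x * (y * t) = x * y * t.
Proof. exact: mulgA. Qed.

Lemma word_prod_cons s u : word_prod (s :: u) = s * word_prod u.
Proof. by rewrite /word_prod big_cons. Qed.

Lemma word_prod_nil : word_prod [::] = 1 :> W.
Proof. by rewrite /word_prod big_nil. Qed.

Lemma word_prod_cat u v : word_prod (u ++ v) = word_prod u * word_prod v.
Proof. by rewrite /word_prod big_cat. Qed.

Lemma word_prod_rcons u s : word_prod (rcons u s) = word_prod u * s.
Proof. by rewrite -cats1 word_prod_cat word_prod_cons word_prod_nil mulg1. Qed.

Lemma gen_sq s : s \in S -> s * s = 1.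
Proof.
by case: hS => h _ _ /h o2; rewrite -[s * s]/(s ^+ 2) -o2 expg_order.
Qed.

Lemma gen_inv s : s \in S -> s^-1 = s.
Proof. by move=> /gen_sq h; apply: (mulgI s); rewrite mulgV h. Qed.

(** The left reflections of the word [u]: multiplying by one of them deletes
    a letter.  They are listed with multiplicity, as [u] may be unreduced. *)
Fixpoint inversions u : seq W :=
  if u is s :: v then s :: [seq y ^ s^-1 | y <- inversions v] else [::].

Lemma size_inversions u : size (inversions u) = size u.
Proof. by elim: u => //= s u IH; rewrite size_map IH. Qed.

Lemma count_inversions_cons x s u :
  count_mem x (inversions (s :: u)) = addn (x == s) (count_mem (x ^ s) (inversions u)).
Proof.
rewrite /= eq_sym; congr (_ + _)%N; rewrite count_map; apply: eq_count => y /=.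
by apply/eqP/eqP => [<-|->]; rewrite ?conjgKV ?conjgK.
Qed.

(** The action of a generator on signed reflections.  It is defined on all
    signed elements of [W], where it is a permutation as well. *)
Definition inv_step s (z : W * bool) : W * bool := (z.1 ^ s, z.2 (+) (z.1 == s)).

Lemma inv_step_inj s : injective (inv_step s).
Proof.
move=> [x a] [y b]; rewrite /inv_step /= => -[/conjg_inj-> h].
by congr (_, _); exact: (addIb h).
Qed.

Definition inv_perm s : {perm (W * bool)} := perm (@inv_step_inj s).

(** The sign counts the occurrences of [x] in [inversions u] modulo 2. *)
Lemma prod_inv_perm u x b :
  (\prod_(s <- u) inv_perm s) (x, b)
  = (x ^ word_prod u, b (+) odd (count_mem x (inversions u))).
Proof.
elim: u x b => [|s u IH] x b.
  by rewrite big_nil perm1 word_prod_nil conjg1 addbF.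
rewrite big_cons permM permE IH count_inversions_cons.
by rewrite word_prod_cons conjgM oddD oddb addbA.
Qed.

Lemma inversions_dihedral s t n : s \in S -> t \in S ->
  inversions (flatten (nseq n [:: s; t]))
  = [seq (s * t) ^+ i * s | i <- iota 0 n.*2].
Proof.
move=> Ss St; elim: n => [|n IH] //=.
rewrite IH (iotaDl 2 0) -!map_comp expg0 mul1g; congr [:: _, _ & _].
  by rewrite expg1 /conjg invgK !gen_inv // mulWA.
apply: eq_map => i /=.
by rewrite /conjg !invgK !gen_inv // !expgS -[_ ^+ i * s * t]mulWA -expgSr expgS !mulWA.
Qed.

(** Among the reflections [(s * t) ^+ i * s], with [i] below twice the order of
    [s * t], each occurs twice, so that no sign changes. *)
Lemma inv_perm_relation s t : s \in S -> t \in S ->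
  (inv_perm s * inv_perm t) ^+ #[s * t] = 1.
Proof.
move=> Ss St; set m := #[s * t].
have E n : (inv_perm s * inv_perm t) ^+ n
         = \prod_(a <- flatten (nseq n [:: s; t])) inv_perm a.
  elim: n => [|n IH]; first by rewrite big_nil.
  by rewrite expgS IH /= !big_cons mulgA.
have P n : word_prod (flatten (nseq n [:: s; t])) = (s * t) ^+ n.
  elim: n => [|n IH]; first by rewrite word_prod_nil.
  by rewrite /= !word_prod_cons IH expgS mulWA.
apply/permP => -[x b]; rewrite E prod_inv_perm P expg_order conjg1 perm1.
rewrite inversions_dihedral // -addnn iotaD map_cat count_cat add0n.
rewrite -{2}[m]addn0 iotaDl -map_comp.
rewrite [X in (_ + count_mem _ X)%N](_ : _ = [seq (s * t) ^+ i * s | i <- iota 0 m]).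
  by rewrite addnn odd_double addbF.
by apply: eq_map => i /=; rewrite expgD expg_order mul1g.
Qed.

(** By the presentation, the signed action factors through [W]. *)
Lemma inversions_parity u v x : word_in S u -> word_in S v ->
  word_prod u = word_prod v ->
  odd (count_mem x (inversions u)) = odd (count_mem x (inversions v)).
Proof.
case: hS => _ _ univ.
have [g gS] := univ _ inv_perm inv_perm_relation.
have g1 : g 1 = 1 by apply: (mulgI (g 1)); rewrite -gmulfM !mulg1.
have gE a : word_in S a -> g (word_prod a) = \prod_(s <- a) inv_perm s.
  elim: a => [|s a IH] /=; first by rewrite word_prod_nil big_nil.
  by case/andP => Ss Sa; rewrite word_prod_cons big_cons gmulfM gS // IH.
move=> Su Sv uv; have := gE u Su; rewrite uv gE // => /permP/(_ (x, false)).
by rewrite !prod_inv_perm /= => -[_ ->].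
Qed.

(** The size of a word is the number of its reflections. *)
Lemma size_parity u v : word_in S u -> word_in S v ->
  word_prod u = word_prod v -> odd (size u) = odd (size v).
Proof.
move=> Su Sv uv.
have E (l : seq W) : odd (size l) = \big[addb/false]_(x : W) odd (count_mem x l).
  elim: l => [|a l IH]; first by rewrite big1.
  rewrite /= IH (bigD1 a) //= [in RHS](bigD1 a) //= eqxx oddD addTb -addNb.
  congr (_ (+) _); apply: eq_bigr => x xa.
  by rewrite [a == x]eq_sym (negPf xa).
rewrite -(size_inversions u) -(size_inversions v) !E.
by apply: eq_bigr => x _; apply: inversions_parity.
Qed.

Lemma mem_inversions u t : word_in S u -> t \in inversions u ->
  exists u1 a u2, u = u1 ++ a :: u2 /\ t * word_prod u = word_prod (u1 ++ u2).
Proof.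
elim: u t => // s u IH t /= /andP[Ss Su]; rewrite inE => /orP[/eqP->|].
  by exists [::], s, u; rewrite word_prod_cons mulWA gen_sq // mul1g.
case/mapP => y /(IH _ Su)[u1 [a [u2 [-> h]]]] ->.
exists (s :: u1), a, u2; split => //.
by rewrite word_prod_cons /= word_prod_cons -h /conjg invgK -!mulWA mulKg.
Qed.

Lemma word_exists w :
  exists n, [exists u : n.-tuple W, word_in S u && (word_prod u == w)].
Proof.
have : w \in <<S>> by case: hS => _ -> _; rewrite inE.
case/gen_prodgP => n [c Sc ->]; exists n; apply/existsP.
exists [tuple c i | i < n]; apply/andP; split.
  by apply/all_tnthP => i; rewrite tnth_mktuple.
by apply/eqP; rewrite /word_prod big_tuple; apply: eq_bigr => i _; rewrite tnth_mktuple.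
Qed.

Definition len w := ex_minn (word_exists w).

Lemma len_word w : exists u, [/\ word_in S u, word_prod u = w & size u = len w].
Proof.
rewrite /len; case: ex_minnP => n /existsP[u /andP[Su /eqP uw]] _.
by exists u; rewrite size_tuple.
Qed.

Lemma len_le u : word_in S u -> len (word_prod u) <= size u.
Proof.
move=> Su; rewrite /len; case: ex_minnP => n _; apply.
by apply/existsP; exists (in_tuple u); rewrite /= Su eqxx.
Qed.

Definition reduced u w := [&& word_in S u, word_prod u == w & size u == len w].

Lemma reducedP u w : 
  reflect [/\ word_in S u, word_prod u = w & size u = len w] (reduced u w).
Proof. by apply: (iffP and3P) => -[? /eqP ? /eqP]. Qed.

Lemma reduced_expressionE u w : reduced_expression S u w = reduced u w.
Proof.
rewrite /reduced_expression /reduced; case Su: (word_in S u) => //=.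
case: eqP => //= uw; apply/idP/eqP => [h|h].
  apply/eqP; rewrite eqn_leq -{2}uw len_le // andbT leqNgt; apply: contra h => h.
  have [v [Sv vw sv]] := len_word w; rewrite -sv in h.
  by apply/existsP; exists (Ordinal h); apply/existsP; exists (in_tuple v); rewrite /= Sv vw eqxx.
apply/existsP => -[[k /= kn] /existsP[v /andP[Sv /eqP vw]]].
by move: kn; rewrite h ltnNge -vw (leq_trans (len_le Sv)) // size_tuple.
Qed.

Lemma reduced_exists w : exists u, reduced u w.
Proof. by have [u ?] := len_word w; exists u; apply/reducedP. Qed.

Lemma len1 : len 1 = 0%N.
Proof. by apply/eqP; rewrite -leqn0 -word_prod_nil len_le. Qed.

Lemma word_inV u : word_in S u -> word_in S (rev u) /\ word_prod (rev u) = (word_prod u)^-1.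
Proof.
rewrite /word_in all_rev => Su; split => //.
elim: u Su => [|s u IH] /=; first by rewrite word_prod_nil invg1.
case/andP => Ss Su; rewrite rev_cons word_prod_rcons IH // word_prod_cons.
by rewrite invMg [s^-1]gen_inv.
Qed.

Lemma lenV w : len w^-1 = len w.
Proof.
have h x : len x^-1 <= len x.
  have [u [Su ux <-]] := len_word x; have [Sr rx] := word_inV Su.
  by rewrite -ux -rx -(size_rev u) len_le.
by apply/eqP; rewrite eqn_leq h -{1}[w]invgK h.
Qed.

Lemma odd_size u : word_in S u -> odd (size u) = odd (len (word_prod u)).
Proof. by move=> Su; have [v [Sv vw <-]] := len_word (word_prod u); apply: size_parity. Qed.

Lemma len_mull s w : s \in S -> len (s * w) = (len w).+1 \/ len w = (len (s * w)).+1.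
Proof.
move=> Ss.
have h x : len (s * x) <= (len x).+1.
  have [u [Su ux <-]] := len_word x; rewrite -ux -word_prod_cons.
  by rewrite -[(size u).+1]/(size (s :: u)) len_le //= Ss.
have h1 := h w; have h2 := h (s * w).
rewrite mulWA gen_sq // mul1g in h2.
have p : odd (len (s * w)) = ~~ odd (len w).
  have [u [Su ux <-]] := len_word w; rewrite -ux -word_prod_cons.
  by rewrite -odd_size //= Ss.
have ne : len (s * w) != len w by apply/eqP => e; move: p; rewrite e; case: odd.
by lia.
Qed.

Lemma len_mulr s w : s \in S -> len (w * s) = (len w).+1 \/ len w = (len (w * s)).+1.
Proof.
by move=> Ss; have := len_mull w^-1 Ss; rewrite -(lenV w) -(lenV (w * s)) invMg (gen_inv Ss).
Qed.

(** If [t] is not a reflection of [u], then [t] occurs evenly often in [u], and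
    hence oddly often in a reduced word [v] for [t * word_prod u], because
    [t :: v] represents the same element as [u].  Deleting a letter of [v] would
    then give a word for [word_prod u] that is too short. *)
Lemma exchange_left t u : t \in S -> word_in S u ->
  len (t * word_prod u) < len (word_prod u) ->
  exists u1 a u2, u = u1 ++ a :: u2 /\ t * word_prod u = word_prod (u1 ++ u2).
Proof.
move=> St Su; set w := word_prod u => lt; apply: (@mem_inversions u t) => //.
have [v [Sv vw sv]] := len_word (t * w).
have tvw : word_prod (t :: v) = w by rewrite word_prod_cons vw mulWA gen_sq // mul1g.
have := @inversions_parity (t :: v) u t _ Su tvw; rewrite /= St Sv => /(_ isT).
case: (boolP (t \in inversions v)) => [/(mem_inversions Sv)|ni].
  case=> v1 [a [v2 [e]]]; rewrite vw mulWA gen_sq // mul1g => wv _.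
  have : len w <= size (v1 ++ v2).
    rewrite wv len_le //; move: Sv; rewrite e /word_in !all_cat /=.
    by case/and3P => -> _ ->.
  by move: sv; rewrite e !size_cat /=; lia.
rewrite eqxx -[count _ _]/(count_mem t (map _ _)) count_map.
rewrite (@eq_count _ _ (pred1 t)); last first.
  by move=> y /=; rewrite -(inj_eq (@conjg_inj _ t)) conjgKV /conjg mulKg.
rewrite (count_memPn ni) /= => /esym; rewrite -has_pred1 has_count.
by case: count.
Qed.

Lemma exchange_right t u : t \in S -> word_in S u ->
  len (word_prod u * t) < len (word_prod u) ->
  exists u1 a u2, u = u1 ++ a :: u2 /\ word_prod u * t = word_prod (u1 ++ u2).
Proof.
move=> St Su lt; have [Sr rE] := word_inV Su.
have [|u1 [a [u2 [e h]]]] := exchange_left St Sr.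
  by rewrite rE lenV -[X in X * _](gen_inv St) -invMg lenV.
exists (rev u2), a, (rev u1); split.
  by rewrite -[u]revK e rev_cat rev_cons cat_rcons.
have Sv : word_in S (u1 ++ u2).
  by move: Sr; rewrite e /word_in !all_cat /=; case/and3P => -> _ ->.
rewrite -rev_cat (word_inV Sv).2 -h rE invMg invgK.
by rewrite (gen_inv St).
Qed.

(** [dem] is the Demazure product, which multiplies by each letter from the
    right when this increases the length; [dem_left] does so from the left. *)
Definition dem_left s x := if len x < len (s * x) then s * x else x.
Definition dem_right x s := if len x < len (x * s) then x * s else x.
Definition dem q := foldl dem_right 1 q.

(** In the only case that is not a comparison of lengths, [t * x] and [x * s]
    are longer than [x] but [t * x * s] is not longer than these.  The exchange
    condition then gives [t * x = x * s]. *)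
Lemma dem_commute s t x : s \in S -> t \in S ->
  dem_right (dem_left t x) s = dem_left t (dem_right x s).
Proof.
move=> Ss St.
have lr y := len_mulr y Ss; have ll y := len_mull y St.
have A := lr x; have B := ll x; have C := lr (t * x); have D := ll (x * s).
rewrite /dem_left /dem_right.
case tx: (len x < len (t * x)); case xs: (len x < len (x * s)); rewrite ?tx ?xs //.
- rewrite mulWA in D *; case h: (_ < len (_ * s)); case h': (_ < len _) => //; try lia.
  have [u [Su ux su]] := len_word x.
  have [||u1 [a [u2 [e h2]]]] := @exchange_left t (rcons u s) St.
  + by rewrite /word_in all_rcons Ss.
  + rewrite word_prod_rcons ux mulWA. lia.
  rewrite word_prod_rcons ux mulWA in h2.
  case/lastP: u2 e h2 => [|u2 b] e h2.
    move: e; rewrite cats1 => /rcons_inj[e _]; rewrite cats0 -e ux in h2.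
     by rewrite -[t * x](mulgK s) h2 gen_inv.
  move: e; rewrite -rcons_cons -rcons_cat => /rcons_inj[e es].
  rewrite -rcons_cat word_prod_rcons -es in h2; move/mulIg: h2 => h2.
  have Sv : word_in S (u1 ++ u2).
    by move: Su; rewrite e /word_in !all_cat /=; case/and3P => -> _ ->.
  have := len_le Sv; rewrite -h2; move: su; rewrite e !size_cat /=; lia.
- by rewrite mulWA in D *; case: ifP => //; lia.
- by rewrite mulWA in D *; case: ifP => //; lia.
Qed.

(** Hence a Demazure product can be evaluated from either end. *)
Lemma dem_foldr q : word_in S q -> dem q = foldr dem_left 1 q.
Proof.
have C x s r : s \in S -> word_in S r -> 
    foldl dem_right (dem_left s x) r = dem_left s (foldl dem_right x r).
  move=> Ss; elim: r x => //= t r IH x /andP[St Sr].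
  by rewrite dem_commute // IH.
elim: q => //= s q IH /andP[Ss Sq]; rewrite -IH // -C //.
by rewrite /dem /= /dem_left /dem_right mul1g mulg1.
Qed.

Definition w0 := [arg max_(w > 1) len w].

Lemma len_w0_max w : len w <= len w0.
Proof. by rewrite /w0; case: arg_maxnP => // x _ h; apply: h. Qed.

(** The letters of [u] are prepended from its end, each time deleting another
    letter of the word for [w0].  The deleted letter never lies in the part of
    [u] already present, since [u] is reduced. *)
Lemma w0_prefix u : reduced u (word_prod u) ->
  exists v, word_in S v /\ reduced (u ++ v) w0.
Proof.
elim: u => [_|s u IH].
  by have [v /reducedP[Sv e sz]] := reduced_exists w0; exists v; rewrite /reduced Sv e sz !eqxx.
case/reducedP => /= /andP[Ss Su] _; rewrite word_prod_cons => szu.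
have [|v [Sv /reducedP[Suv e sz]]] := IH.
  rewrite /reduced Su eqxx /=; have := len_le Su; have := len_mull (word_prod u) Ss; lia.
have [||u1 [a [u2 [e1 h2]]]] := @exchange_left s (u ++ v) Ss => //.
  rewrite e; have := len_w0_max (s * w0); have := len_mull w0 Ss; lia.
have [lt|le] := ltnP (size u1) (size u); last first.
  have eu : u = take (size u) u1.
    by have := congr1 (take (size u)) e1; rewrite take_size_cat // takel_cat.
  have u1E : u1 = u ++ drop (size u) u1 by rewrite {1}eu cat_take_drop.
  set v1 := drop _ _ in u1E.
  have vE : v = v1 ++ a :: u2.
    by move: e1; rewrite u1E -catA => /eqP; rewrite eqseq_cat // => /andP[_ /eqP].
  have Sv1 : word_in S (v1 ++ u2).
    by move: Sv; rewrite vE /word_in !all_cat /=; case/and3P => -> _ ->.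
  exists (v1 ++ u2); split => //; apply/reducedP; split.
  - by rewrite /= Ss /=; move: Su Sv1; rewrite /word_in !all_cat => -> ->.
  - by rewrite /= word_prod_cons catA -u1E -h2 mulWA gen_sq // mul1g.
  - by move: sz; rewrite /= vE !size_cat /=; lia.
exfalso.
have u1E : u1 = take (size u1) u.
  by have := congr1 (take (size u1)) e1; rewrite takel_cat ?take_size_cat // ltnW.
have dE : drop (size u1) u ++ v = a :: u2.
  by have := congr1 (drop (size u1)) e1; rewrite drop_cat lt drop_size_cat.
case e3: (drop (size u1) u) dE => [|b u3] dE.
  by have := size_drop (size u1) u; rewrite e3 /=; lia.
case: dE => _ e2.
have uE : u = u1 ++ b :: u3 by rewrite -e3 {1}u1E cat_take_drop.
have Su3 : word_in S (u1 ++ u3).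
  by move: Su; rewrite uE /word_in !all_cat /=; case/and3P => -> _ ->.
have : s * word_prod u = word_prod (u1 ++ u3).
  by apply: (mulIg (word_prod v)); rewrite -mulWA -!word_prod_cat h2 -e2 catA.
move=> h; have := len_le Su3; rewrite -h -szu uE !size_cat /=; lia.
Qed.

Lemma len_w0V x : (len (x^-1 * w0) + len x)%N = len w0.
Proof.
have [u [Su ux su]] := len_word x.
have [|v [Sv /reducedP[_ e sz]]] := @w0_prefix u.
  by rewrite /reduced Su ux su !eqxx.
have vE : word_prod v = x^-1 * w0.
  by rewrite -e word_prod_cat ux mulKg.
have := len_le Sv; rewrite vE.
have [v' [Sv' vx' <-]] := len_word (x^-1 * w0).
have := @len_le (u ++ v'); rewrite word_prod_cat ux vx' mulKVg.
rewrite /word_in all_cat => /(_ _); rewrite -!/(word_in S _) Su Sv' => /(_ isT).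
by rewrite -sz !size_cat; lia.
Qed.

Lemma len1_gen s : len s = 1%N -> s \in S.
Proof.
have [u [Su <- <-]] := len_word s; case: u Su => [|a [|//]] //= /andP[Sa _] _.
by rewrite word_prod_cons word_prod_nil mulg1.
Qed.

Lemma len_gen s : s \in S -> len s = 1%N.
Proof. by move=> Ss; have := len_mull 1 Ss; rewrite mulg1 len1; lia. Qed.

(** The length formula for [x^-1 * w0], used twice, shows that the conjugate
    has length 1. *)
Lemma gen_conj_w0 s : s \in S -> s ^ w0 \in S.
Proof.
move=> Ss; apply: len1_gen; have := len_w0V (s * w0).
have := len_w0V s; rewrite (gen_inv Ss) (len_gen Ss) invMg (gen_inv Ss) -mulWA -[_ * (s * w0)]/(s ^ w0).
by move=> <- /eqP; rewrite addnC eqn_add2l => /eqP.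
Qed.

Lemma reduced_rotate s u : s \in S ->
  reduced (s :: u) w0 = reduced (rcons u (s ^ w0)) w0.
Proof.
move=> Ss; rewrite /reduced /word_in all_rcons /= Ss gen_conj_w0 // size_rcons.
rewrite word_prod_cons word_prod_rcons; congr [&& _, _ & _].
apply/eqP/eqP => h.
  have -> : word_prod u = s * w0 by rewrite -h mulWA gen_sq // mul1g.
  by rewrite /conjg -mulgA mulKVg mulWA gen_sq // mul1g.
have : word_prod u = s * w0.
  by apply: (mulIg (s ^ w0)); rewrite h /conjg !mulWA mulgK gen_sq // mul1g.
by move=> ->; rewrite mulWA gen_sq // mul1g.
Qed.

Lemma reduced_rcons u s w : s \in S ->
  reduced (rcons u s) w = reduced u (w * s) && (len (w * s) < len w).
Proof.
move=> Ss; apply/reducedP/andP => [[]|[/reducedP[Su e sz] lt]].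
  rewrite /word_in all_rcons => /andP[_ Su]; rewrite word_prod_rcons size_rcons => e sz.
  have uE : word_prod u = w * s by rewrite -e -mulWA gen_sq // mulg1.
  have := len_le Su; have := len_mulr w Ss; rewrite uE => h1 h2.
  split; last lia.
  by apply/reducedP; split => //; lia.
split; first by rewrite /word_in all_rcons Ss.
  by rewrite word_prod_rcons e -mulWA gen_sq // mulg1.
by rewrite size_rcons sz; have := len_mulr w Ss; lia.
Qed.

Lemma reduced_exchange u s w : s \in S -> reduced u w -> len (w * s) < len w ->
  exists u1 a u2, u = u1 ++ a :: u2 /\ reduced (u1 ++ u2) (w * s).
Proof.
move=> Ss /reducedP[Su e sz] lt.
have [|u1 [a [u2 [e1 h]]]] := exchange_right Ss Su; first by rewrite e.
exists u1, a, u2; split => //; apply/reducedP; split.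
- by move: Su; rewrite e1 /word_in !all_cat /=; case/and3P => -> _ ->.
- by rewrite -h e.
- by move: sz; rewrite e1 !size_cat /=; have := len_mulr w Ss; lia.
Qed.

(** Reading [q] from its end, [w] is replaced by [w * s] whenever this is
    shorter; this turns [w] into 1 because [q] contains a reduced word for it.
    Under [x |-> x^-1 * w0] these steps are the operators [dem_left s]. *)
Lemma subseq_dem q u w : word_in S q -> subseq u q -> reduced u w ->
  foldr dem_left (w^-1 * w0) q = w0.
Proof.
elim/last_ind: q u w => [|q s IH] u w.
  by move=> _; rewrite subseq0 => /eqP->; case/reducedP => _ <- _; rewrite word_prod_nil invg1 mul1g.
rewrite /word_in all_rcons => /andP[Ss Sq] sub ru.
rewrite foldr_rcons /dem_left.
have l1 := len_w0V w; have l3 := len_mulr w Ss.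
have l2 : (len (s * (w^-1 * w0)) + len (w * s))%N = len w0.
  by rewrite -(len_w0V (w * s)) invMg (gen_inv Ss) -mulgA.
have subP : subseq u q \/ exists2 u', u = rcons u' s & subseq u' q.
  case/lastP: u {ru} sub => [|u' a]; first by left; apply: sub0seq.
  rewrite -subseq_rev !rev_rcons /=; case: eqP => [->|_].
    by rewrite subseq_rev => h; right; exists u'.
  by rewrite -rev_rcons subseq_rev => h; left.
case: ifP => lt.
  have {}lt : len (w * s) < len w by lia.
  rewrite -{1}(gen_inv Ss) mulWA -invMg.
  case: subP => [sub'|[u' ue sub']].
    have [u1 [a [u2 [e h]]]] := reduced_exchange Ss ru lt.
    apply: IH h => //; apply: subseq_trans sub'; rewrite e.
    by apply: cat_subseq => //; apply: subseq_cons.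
  by apply: (IH u') => //; move: ru; rewrite ue reduced_rcons // => /andP[].
case: subP => [sub'|[u' ue sub']]; first by apply: IH ru.
by move: ru; rewrite ue reduced_rcons // => /andP[_]; lia.
Qed.

Lemma len_foldl_dem x q : word_in S q -> len (foldl dem_right x q) <= len x + size q.
Proof.
elim: q x => [|s q IH] x /=; first by rewrite addn0.
case/andP => Ss Sq; apply: leq_trans (IH _ Sq) _.
by rewrite /dem_right; case: ifP; have := len_mulr x Ss; lia.
Qed.

(** For [w0] the preceding fold starts at 1 and is the Demazure product of the
    word, whose length grows by at most 1 with each letter. *)
Lemma dem_no_w0 q v u : word_in S q -> word_in S v ->
  len (dem q) + size v < len w0 -> subseq u (q ++ v) -> ~~ reduced u w0.
Proof.
move=> Sq Sv lt sub; apply/negP => ru.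
have Sqv : word_in S (q ++ v) by rewrite /word_in all_cat; apply/andP.
have := subseq_dem Sqv sub ru; rewrite mulVg -dem_foldr // /dem foldl_cat.
move=> e; have := len_foldl_dem (dem q) Sv; rewrite /dem e; move: lt; rewrite /dem; lia.
Qed.

Lemma dem_rcons q s : dem (rcons q s) = dem_right (dem q) s.
Proof. by rewrite /dem foldl_rcons. Qed.

End Coxeter.

(** * Vertex decompositions and shellings of complexes *)

Section Complexes.
Import mathcomp.boot.fintype mathcomp.boot.finset.
Local Open Scope set_scope.
Variable V : finType.
Implicit Types (D L X : {set {set V}}) (A F G H I J : {set V}) (v : V).

Definition down_closed D := forall I J, J \in D -> I \subset J -> I \in D.

Lemma facetP D F :
  reflect (F \in D /\ forall G, G \in D -> F \subset G -> G = F) (facet D F).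
Proof. by apply: (iffP maxsetP) => /=. Qed.

Lemma facet_exists D J : J \in D -> exists2 F, facet D F & J \subset F.
Proof.
by move=> JD; have [F fF JF] := @maxset_exists _ [pred G in D] J JD; exists F.
Qed.

Lemma pureP D : pure D <-> forall F G, facet D F -> facet D G -> #|F| = #|G|.
Proof.
split=> h F G fF fG; last by rewrite /face_dim (h F G).
by have := h F G fF fG; rewrite /face_dim => /addIr [].
Qed.

Lemma in_del1 D v J : (J \in del D [set v]) = (J \in D) && (v \notin J).
Proof. by rewrite inE sub1set. Qed.

Lemma in_link1 D v J :
  (J \in link D [set v]) = [&& J \in D, v |: J \in D & v \notin J].
Proof. by rewrite inE setI_eq0 disjoints1. Qed.

Lemma costarP D I J :
  reflect (J \in D /\ exists F, [/\ facet D F, ~~ (I \subset F) & J \subset F])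
          (J \in costar D I).
Proof.
rewrite inE; apply: (iffP andP) => -[JD].
  by case/existsP => F /and3P[? ? ?]; split => //; exists F.
by case=> F [? ? ?]; split => //; apply/existsP; exists F; apply/and3P.
Qed.

Lemma del_closed D I : down_closed D -> down_closed (del D I).
Proof.
move=> cD J K; rewrite !inE => /andP[KD nI] JK; rewrite (cD J K) //=.
by apply: contra nI => h; apply: subset_trans JK.
Qed.

Lemma link_closed D v : down_closed D -> down_closed (link D [set v]).
Proof.
move=> cD J K; rewrite !in_link1 => /and3P[KD vK nv] JK.
rewrite (cD J K) // (cD _ _ vK) ?setUS //=.
by apply: contra nv; apply/subsetP.
Qed.

Lemma costar_closed D I : down_closed D -> down_closed (costar D I).
Proof.
move=> cD J K /costarP[KD [F [fF nF KF]]] JK; apply/costarP; split.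
  exact: cD KD JK.
by exists F; split => //; apply: subset_trans KF.
Qed.

Lemma vd_pure D : vertex_decomposable D -> pure D.
Proof.
case=> // {}D [->|[F ->]]; apply/pureP => G H /facetP[].
  by rewrite inE.
rewrite inE => GF mG /facetP[]; rewrite inE => HF mH.
have FF : F \in powerset F by rewrite inE.
by rewrite -(mG F FF GF) -(mH F FF HF).
Qed.

(** The join of the simplex on [A] with [D]; for [A = [set v]] it is the cone
    with apex [v]. *)
Definition join A D : {set {set V}} := [set J | J :\: A \in D].

Definition avoids D A := forall J, J \in D -> [disjoint J & A].

Lemma in_join A D J : (J \in join A D) = (J :\: A \in D).
Proof. by rewrite inE. Qed.

Lemma join_powerset A F : join A (powerset F) = powerset (A :|: F).
Proof. by apply/setP => J; rewrite !inE subDset. Qed.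

Lemma join_set0 A : join A set0 = set0.
Proof. by apply/setP => J; rewrite !inE. Qed.

Lemma setDU_disjoint A G : [disjoint G & A] -> (A :|: G) :\: A = G.
Proof.
by move=> dG; rewrite setDUl setDv set0U; apply/setDidPl.
Qed.

Lemma facet_join A D F : avoids D A -> facet (join A D) F ->
  A \subset F /\ facet D (F :\: A).
Proof.
move=> av /facetP[]; rewrite inE => FD mF.
have AF : A \subset F.
  rewrite -(mF (A :|: F)) ?subsetUl ?subsetUr // inE.
  by rewrite setDUl setDv set0U.
split => //; apply/facetP; split => // G GD FG.
have := mF (A :|: G); rewrite inE setDU_disjoint ?av // => <- //.
  by rewrite setDU_disjoint ?av.
by rewrite -subDset.
Qed.

(** A vertex of the base avoids the simplex, and deletion and link of it
    commute with the join, so that a decomposition of the base is one of the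
    join; only the purity of joins has to be checked. *)
Lemma vd_join A D : avoids D A ->
  vertex_decomposable D -> vertex_decomposable (join A D).
Proof.
move=> + vD; elim: vD => {D} [D [->|[F ->]] _|D v pD vD _ IHd _ IHl av].
- by rewrite join_set0; apply: VD_simplex; left.
- by rewrite join_powerset; apply: VD_simplex; right; exists (A :|: F).
have vA : v \notin A by move: (av _ vD); rewrite disjoints1.
have vDA J : (v \in J :\: A) = (v \in J) by rewrite inE vA.
apply: (@VD_vertex _ _ v).
- apply/pureP => F G /(facet_join av)[AF fF] /(facet_join av)[AG fG].
  have /pureP/(_ _ _ fF fG) := pD; rewrite !cardsD (setIidPr AF) (setIidPr AG).
  by have := subset_leq_card AF; have := subset_leq_card AG; lia.
- by rewrite inE setDE (setIidPl _) // sub1set inE.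
- rewrite (_ : del _ _ = join A (del D [set v])).
    by apply: IHd => J; rewrite inE => /andP[/av].
  by apply/setP => J; rewrite in_del1 !in_join in_del1 vDA.
rewrite (_ : link _ _ = join A (link D [set v])).
  by apply: IHl => J; rewrite inE => /andP[/av].
apply/setP => J; rewrite in_link1 !in_join in_link1 vDA setDUl.
by have /setDidPl -> : [disjoint [set v] & A]; rewrite ?disjoints1.
Qed.

(** Purity in terms of faces rather than facets, so that it can be read off
    from unions and intersections.  It holds for the void complex and all [d]. *)
Definition pure_card D d :=
  forall J, J \in D -> #|J| <= d /\ exists F, [/\ F \in D, J \subset F & #|F| = d].

Lemma facet_card D d F : pure_card D d -> facet D F = (F \in D) && (#|F| == d).
Proof.
move=> pD; apply/facetP/andP => -[FD h].
  by split => //; have [_ [G [GD FG <-]]] := pD F FD; rewrite (h G).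
split => // G GD FG; apply/esym/eqP; rewrite eqEcard FG (eqP h).
by have [] := pD G GD.
Qed.

Lemma pure_card_pure D d : pure_card D d -> pure D.
Proof.
move=> pD; apply/pureP => F G; rewrite !(facet_card _ pD).
by move=> /andP[_ /eqP->] /andP[_ /eqP->].
Qed.

Lemma pure_card_dim D d : pure_card D d -> D != set0 -> \max_(F in D) #|F| = d.
Proof.
move=> pD /set0Pn[J JD]; apply/eqP; rewrite eqn_leq; apply/andP; split.
  by apply/bigmax_leqP => F FD; have [] := pD F FD.
by have [_ [F [FD _ <-]]] := pD J JD; apply: leq_bigmax_cond.
Qed.

Lemma pure_pure_card D : pure D -> pure_card D (\max_(F in D) #|F|).
Proof.
move=> /pureP pD J JD; split; first exact: (leq_bigmax_cond (F := fun F : {set V} => #|F|)).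
have [F fF JF] := facet_exists JD; exists F; split => //; first by case/facetP: fF.
apply/eqP; rewrite eqn_leq (leq_bigmax_cond (F := fun F : {set V} => #|F|)) /=; last by case/facetP: fF.
apply/bigmax_leqP => G GD; have [H fH GH] := facet_exists GD.
by rewrite (pD F H) // subset_leq_card.
Qed.

(** If [F] is the only facet, the void complex is left after its removal. *)
Lemma costar_set0 D F : down_closed D -> facet D F -> costar D F = set0 ->
  D = powerset F.
Proof.
move=> cD /facetP[FD mF] c0; apply/setP => J; rewrite inE.
apply/idP/idP => [JD|]; last exact: cD.
have [H fH JH] := facet_exists JD; have [HD _] := facetP _ _ fH.
suff FH : F \subset H by rewrite -(mF H).
apply/negPn/negP => n; have : H \in costar D F by apply/costarP; split => //; exists H.
by rewrite c0 inE.
Qed.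

(** One step of a shelling of [X :|: join [set v] L]: over the last facet [G]
    of a shelling of [L] lies the facet [v |: G].  It meets the earlier facets
    in the join of [v] with the corresponding intersection for [G], together
    with all of the powerset of [G] when [X] contains [L]. *)
Lemma shelling_step X L v d G :
    down_closed X -> down_closed L -> avoids X [set v] -> avoids L [set v] ->
    pure_card L d -> X = set0 \/ (L \subset X /\ pure_card X d.+1) ->
    facet L G -> X != set0 \/ costar L G != set0 ->
    (forall J, J \in powerset G :&: costar L G ->
       exists H, [/\ H \in powerset G :&: costar L G, J \subset H & #|H|.+1 = d]) ->
    shellable (X :|: join [set v] (costar L G)) ->
  shellable (X :|: join [set v] L).
Proof.
move=> cX cL aX aL pL hX fG ne hZ sh.
have vX J : J \in X -> v \notin J by move/aX; rewrite disjoint_sym disjoints1.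
have vL J : J \in L -> v \notin J by move/aL; rewrite disjoint_sym disjoints1.
set D := X :|: _; set L' := costar L G in ne hZ sh *.
have GL : G \in L by case/facetP: fG.
have Gd : #|G| = d by move: fG; rewrite (facet_card _ pL) => /andP[_ /eqP].
have inD J : (J \in D) = (J \in X) || (J :\ v \in L) by rewrite in_setU in_join.
have v1D J : v \notin J -> J :\ v = J by move=> h; apply/setDidPl; rewrite disjoint_sym disjoints1.
have v1L J : J \in L -> v |: J \in D by move=> JL; rewrite inD setU1K ?JL ?orbT ?vL.
have c1L J : J \in L -> #|v |: J| = #|J|.+1 by move=> JL; rewrite cardsU1 vL.
have pD : pure_card D d.+1.
  move=> J; rewrite inD => /orP[JX|JL].
    case: hX => [X0|[LX pX]]; first by rewrite X0 inE in JX.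
    have [le [F [FX JF cF]]] := pX J JX; split => //; exists F.
    by rewrite inD FX.
  have [le [F [FL JF cF]]] := pL _ JL; split.
    by rewrite (cardsD1 v J); case: (v \in J); lia.
  by exists (v |: F); rewrite v1L // -subDset JF c1L // cF.
have fvG : facet D (v |: G) by rewrite (facet_card _ pD) v1L // c1L // Gd eqxx.
have L'L : L' \subset L by apply/subsetP => J; rewrite inE => /andP[].
have cstar : costar D (v |: G) = X :|: join [set v] L'.
  apply/setP => J; rewrite in_setU in_join; apply/costarP/orP.
    case=> JD [H [fH nH JH]].
    move: fH; rewrite (facet_card _ pD) inD => /andP[HD /eqP cH].
    case/orP: HD => [HX|HL]; first by left; apply: cX JH.
    have vH : v \in H.
      apply/negPn/negP => nv; rewrite v1D // in HL.
      by have [+ _] := pL H HL; rewrite cH ltnn.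
    right; apply/costarP; split; first by apply: cL (setSD _ JH).
    exists (H :\ v); split; last exact: setSD.
      by rewrite (facet_card _ pL) HL /= -eqSS -cH (cardsD1 v H) vH.
    by apply: contra nH => GH; rewrite subUset sub1set vH (subset_trans GH) ?subD1set.
  case=> [JX|/costarP[JL [H [fH nH JH]]]].
    split; first by rewrite inD JX.
    case: hX => [X0|[LX pX]]; first by rewrite X0 inE in JX.
    have [_ [H [HX JH cH]]] := pX J JX; exists H; split => //.
      by rewrite (facet_card _ pD) inD HX cH eqxx.
    by rewrite subUset sub1set negb_and vX.
  split; first by rewrite inD JL orbT.
  have HL : H \in L by case/facetP: fH.
  have cH : #|H| = d by move: fH; rewrite (facet_card _ pL) => /andP[_ /eqP].
  exists (v |: H); split; last by rewrite -subDset.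
    by rewrite (facet_card _ pD) v1L // c1L // cH eqxx.
  apply: contra nH => h; apply/subsetP => x xG.
  have /subsetP/(_ x) := h; rewrite !inE xG orbT => /(_ isT) /orP[/eqP e|//].
  by have := vL G GL; rewrite -e xG.
set Z := powerset (v |: G) :&: costar D (v |: G).
have inZ J : (J \in Z) = [&& J \subset v |: G & (J \in X) || (J :\ v \in L')].
  by rewrite /Z cstar in_setI in_setU powersetE in_join.
have pZ : pure_card Z d.
  move=> J; rewrite inZ => /andP[JF JD]; split.
    rewrite -ltnS -Gd -(c1L G GL); apply: proper_card; rewrite properEneq JF andbT.
    apply/eqP => JE; rewrite JE in JD; case/orP: JD => [/vX|].
      by rewrite setU11.
    rewrite setU1K ?vL // => /costarP[_ [H [_ nH GH]]].
    by rewrite GH in nH.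
  have GZ : X != set0 -> v \notin J -> exists F, [/\ F \in Z, J \subset F & #|F| = d].
    move=> X0 vJ; exists G; split => //.
      case: hX => [e|[LX _]]; first by rewrite e eqxx in X0.
      by rewrite inZ subsetUr (subsetP LX).
    by rewrite -(v1D J vJ) subDset.
  case/orP: JD => [JX|JL'].
    by apply: GZ; [apply/set0Pn; exists J | apply: vX].
  have [|H [HZ JH cH]] := hZ (J :\ v); first by rewrite in_setI powersetE subDset JF JL'.
  move: HZ; rewrite in_setI powersetE => /andP[HG HL'].
  have HL : H \in L by apply: (subsetP L'L).
  exists (v |: H); split; last by rewrite c1L.
    by rewrite inZ setUS // setU1K ?vL ?HL' ?orbT.
  by rewrite -subDset.
have Z0 : Z != set0.
  have [J JXL] : exists J, (J \in X) || (J \in L').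
    by case: ne => /set0Pn[J JX]; exists J; rewrite JX ?orbT.
  apply/set0Pn; exists set0; rewrite inZ sub0set /= set0D.
  case/orP: JXL => J'; first by rewrite (cX _ _ J') ?sub0set.
  by rewrite (costar_closed cL J') ?sub0set ?orbT.
have D0 : D != set0 by apply/set0Pn; exists (v |: G); apply: v1L.
apply: (@Sh_facet _ _ (v |: G)) => //.
- exact: pure_card_pure pD.
- by rewrite cstar.
- exact: pure_card_pure pZ.
by rewrite /complex_dim (pure_card_dim pD) // (pure_card_dim pZ) // -addn1 PoszD; ring.
Qed.

(** The facets of [X] come first, followed by the cones over the facets of [L].
    The void [X] is the case of a cone, where all facets contain [v]. *)
Lemma shellable_glue X L v d :
    down_closed X -> down_closed L -> avoids X [set v] -> avoids L [set v] ->
    pure_card L d -> X = set0 \/ (L \subset X /\ pure_card X d.+1) ->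
  shellable X -> shellable L -> shellable (X :|: join [set v] L).
Proof.
move=> cX + aX + + + shX shL.
have simpG G : avoids (powerset G) [set v] -> down_closed (powerset G) ->
    pure_card (powerset G) d -> X = set0 \/ (powerset G \subset X /\ pure_card X d.+1) ->
    shellable (X :|: join [set v] (powerset G)).
  move=> aG cG pG hX; have [X0|X0] := eqVneq X set0.
    by rewrite X0 set0U join_powerset; apply: Sh_simplex; right; exists (v |: G).
  have fG : facet (powerset G) G.
    apply/facetP; rewrite inE; split => // H; rewrite inE => HG GH.
    by apply/eqP; rewrite eqEsubset HG.
  have c0 : costar (powerset G) G = set0.
    apply/eqP; rewrite -subset0; apply/subsetP => J.
    move=> /costarP[_ [F [/facetP[]]]]; rewrite powersetE => FG mF /negP[].
    by rewrite -(mF G _ FG) // powersetE.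
  apply: (shelling_step (G := G) (d := d)) => //; first by left.
    by move=> J; rewrite c0 !inE andbF.
  by rewrite c0 join_set0 setU0.
elim: shL => {L} [L [->|[G ->]]|L G pL fG _ IH pZ dZ] cL aL pcL hX.
- by rewrite join_set0 setU0.
- exact: simpG.
have [L'0|L'0] := eqVneq (costar L G) set0.
  have LE := costar_set0 cL fG L'0.
  by rewrite LE in aL cL pcL hX *; apply: simpG.
have L'L : costar L G \subset L by apply/subsetP => J; rewrite inE => /andP[].
have GL : G \in L by case/facetP: fG.
apply: (shelling_step (G := G) (d := d)) => //; first by right.
  move=> J JZ; have [_ [F [FZ JF cF]]] := pure_pure_card pZ JZ.
  exists F; split => //; rewrite cF.
  move: dZ; rewrite /complex_dim (pure_card_dim pcL); last by apply/set0Pn; exists G.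
  lia.
apply: IH.
- exact: costar_closed.
- by move=> J JL; apply: aL; apply: (subsetP L'L).
- move=> J /costarP[JL [F [fF nF JF]]]; split; first by have [] := pcL J JL.
  move: (fF); rewrite (facet_card _ pcL) => /andP[FL /eqP cF]; exists F; split => //.
  by apply/costarP; split => //; exists F.
- by case: hX => [|[LX pX]]; [left|right; split => //; apply: subset_trans LX].
Qed.

(** Adding the cone over the link to the deletion is a shelling in which the
    facets without [v] come first.  When every facet contains [v], the complex
    is the cone over its link and there are none of these. *)
Theorem vd_shellable D : down_closed D -> vertex_decomposable D -> shellable D.
Proof.
move=> + vD; elim: vD => {D} [D sD _|D v pD vD vdd IHd vdl IHl cD].
  exact: Sh_simplex.
have pcD := pure_pure_card pD; set e := \max_(F in D) #|F| in pcD.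
have cd : down_closed (del D [set v]) by apply: del_closed.
have cl : down_closed (link D [set v]) by apply: link_closed.
have ad : avoids (del D [set v]) [set v].
  by move=> J; rewrite in_del1 disjoint_sym disjoints1 => /andP[].
have al : avoids (link D [set v]) [set v].
  by move=> J; rewrite in_link1 disjoint_sym disjoints1 => /and3P[].
have e0 : 0 < e by have [] := pcD _ vD; rewrite cards1.
have pl : pure_card (link D [set v]) e.-1.
  move=> J; rewrite in_link1 => /and3P[JD vJD vJ]; split.
    by have [] := pcD _ vJD; rewrite cardsU1 vJ; lia.
  have [_ [F [FD vJF cF]]] := pcD _ vJD.
  have vF : v \in F by apply: (subsetP vJF); rewrite setU11.
  exists (F :\ v); split.
  - by rewrite in_link1 setD1K // FD setD11 (cD _ _ FD) // subD1set.
  - by rewrite -(setU1K vJ) setSD.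
  - by have := cardsD1 v F; rewrite vF cF => ->.
have setU1D1 J : v |: (J :\ v) = v |: J.
  by apply/setP => x; rewrite !inE; case: (x == v).
have joinP J : (J \in join [set v] (link D [set v])) = (v |: J \in D).
  rewrite inE in_link1 setD11 andbT; apply/andP/idP => [[_]|vJ].
    by rewrite setU1D1.
  split; last by rewrite setU1D1 vJ.
  by apply: cD vJ _; apply: subset_trans (subD1set _ _) (subsetUr _ _).
have [/existsP[H /and3P[HD cH vH]]|noH] := boolP [exists H, [&& H \in D, #|H| == e & v \notin H]].
  rewrite (_ : D = del D [set v] :|: join [set v] (link D [set v])).
    apply: (shellable_glue (d := e.-1)) => //; [|exact: IHd|exact: IHl].
    right; split.
      by apply/subsetP => J; rewrite in_link1 in_del1 => /and3P[-> _ ->].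
    have HX : H \in del D [set v] by rewrite in_del1 HD vH.
    have pX := pure_pure_card (vd_pure vdd).
    rewrite prednK // -[X in pure_card _ X](_ : \max_(F in del D [set v]) #|F| = e) //.
    apply/eqP; rewrite eqn_leq; apply/andP; split.
      by apply/bigmax_leqP => F; rewrite in_del1 => /andP[/pcD[]].
    by rewrite -(eqP cH) (leq_bigmax_cond (F := fun F : {set V} => #|F|)).
  apply/setP => J; rewrite in_setU in_del1 joinP; apply/idP/orP => [JD|].
    have [vJ|vJ] := boolP (v \in J); last by left; rewrite JD.
    by right; rewrite (setUidPr _) // sub1set.
  by case=> [/andP[]//|vJ]; apply: cD vJ (subsetUr _ _).
rewrite (_ : D = set0 :|: join [set v] (link D [set v])).
  apply: (shellable_glue (d := e.-1)) => //.
  - by move=> J K; rewrite inE.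
  - by move=> J; rewrite inE.
  - by left.
  - by apply: Sh_simplex; left.
  - exact: IHl.
apply/setP => J; rewrite set0U joinP; apply/idP/idP => [JD|vJ]; last first.
  by apply: cD vJ (subsetUr _ _).
have [_ [F [FD JF cF]]] := pcD _ JD.
have vF : v \in F.
  by apply: contraNT noH => vF; apply/existsP; exists F; rewrite FD cF eqxx vF.
by apply: (cD _ _ FD); rewrite subUset JF sub1set vF.
Qed.

End Complexes.

(** * Complexes on a larger vertex set *)

Section Pullback.
Import mathcomp.boot.fintype mathcomp.boot.finset.
Local Open Scope set_scope.
Variables (V V' : finType) (f : V -> V').
Hypothesis f_inj : injective f.
Implicit Types (D : {set {set V'}}) (I J F : {set V}) (K : {set V'}).

(** For a complex whose faces lie in the image of [f], the pullback is the same
    complex without the other, idle vertices. *)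
Definition pullback D : {set {set V}} := [set I : {set V} | f @: I \in D].

Definition supported D := forall K, K \in D -> K \subset f @: [set: V].

Lemma supportedP D : supported D -> forall K, K \in D -> f @: (f @^-1: K) = K.
Proof.
move=> sD J JD; apply/setP => y; apply/imsetP/idP => [[x]|yJ].
  by rewrite inE => ? ->.
have /imsetP[x _ yx] := subsetP (sD J JD) y yJ.
by exists x; rewrite ?inE -?yx.
Qed.

Lemma sub_imset_inj I J : (f @: I \subset f @: J) = (I \subset J).
Proof.
apply/idP/idP => [|/imsetS->//].
by move=> /subsetP h; apply/subsetP => x /(imset_f f)/h; rewrite mem_imset.
Qed.

Lemma facet_pullback D F : supported D -> facet (pullback D) F = facet D (f @: F).
Proof.
move=> sD; apply/facetP/facetP; rewrite inE => -[FD h]; split => // G.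
  move=> GD FG; rewrite -(supportedP sD GD) (h (f @^-1: G)) //.
    by rewrite inE (supportedP sD GD).
  by rewrite -sub_imset_pre.
rewrite inE => GD FG; apply: (imset_inj f_inj); apply: h => //.
by rewrite sub_imset_inj.
Qed.

Lemma costar_pullback D I : supported D ->
  costar (pullback D) I = pullback (costar D (f @: I)).
Proof.
move=> sD; apply/setP => J; rewrite [RHS]inE.
apply/costarP/costarP; rewrite inE => -[JD [F [fF nF JF]]]; split => //.
  by exists (f @: F); rewrite -facet_pullback // !sub_imset_inj.
have FD : F \in D by case/facetP: fF.
exists (f @^-1: F); rewrite facet_pullback // -[I \subset _]sub_imset_inj.
by rewrite -[J \subset _]sub_imset_inj (supportedP sD FD).
Qed.

Lemma vd_pullback D : supported D ->
  vertex_decomposable D -> vertex_decomposable (pullback D).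
Proof.
move=> + vD; elim: vD => {D} [D [->|[F ->]] _|D v' pD vD _ IHd _ IHl sD].
- by apply: VD_simplex; left; apply/setP => J; rewrite !inE.
- apply: VD_simplex; right; exists (f @^-1: F); apply/setP => J.
  by rewrite !inE sub_imset_pre.
have [v _ v'E] : exists2 v, v \in [set: V] & v' = f v.
  by apply/imsetP; apply: (subsetP (sD _ vD)); rewrite inE.
apply: (@VD_vertex _ _ v).
- apply/pureP => F G; rewrite !facet_pullback // => fF fG.
  have /pureP/(_ _ _ fF fG) := pD.
  by rewrite !card_imset.
- by rewrite inE imset_set1 -v'E.
- rewrite (_ : del _ _ = pullback (del D [set v'])).
    by apply: IHd => J; rewrite inE => /andP[/sD].
  by apply/setP => J; rewrite in_del1 !(inE, in_del1) v'E mem_imset.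
rewrite (_ : link _ _ = pullback (link D [set v'])).
  by apply: IHl => J; rewrite inE => /andP[/sD].
by apply/setP => J; rewrite in_link1 !(inE, in_link1) v'E mem_imset // imsetU1.
Qed.

End Pullback.

(** * Subword complexes of labelled sequences of positions *)

Section SubwordComplexes.
Import mathcomp.boot.fintype mathcomp.boot.finset.
Local Open Scope set_scope.
Local Open Scope group_scope.
Variables (W : finGroupType) (S : {set W}) (hS : coxeter_system S).
Implicit Types (w : W).

Section Labelled.
Variables (V : finType) (q : V -> W).
Implicit Types (p : seq V) (F G I J : {set V}) (v : V).

(** The word read along the positions [p], labelled by [q], outside of [F]. *)
Definition word p F : seq W := [seq q v | v <- p & v \notin F].

(** The subword complex of a word whose positions are listed by [p].  Arbitrary
    position types allow for shortening, rotating and extending the word. *)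
Definition cplx p w : {set {set V}} :=
  [set I : {set V} |
     [exists F : {set V}, [&& I \subset F, F \subset p & reduced hS (word p F) w]]].

Definition labelled p := {in p, forall v, q v \in S}.

Lemma cplxP p w I :
  reflect (exists F, [/\ I \subset F, F \subset p & reduced hS (word p F) w])
          (I \in cplx p w).
Proof.
by rewrite inE; apply: (iffP existsP) => -[F]; [case/and3P|move/and3P]; exists F.
Qed.

Lemma cplx_closed p w : down_closed (cplx p w).
Proof.
move=> I J /cplxP[F [JF Fp rF]] IJ; apply/cplxP; exists F; split => //.
exact: subset_trans JF.
Qed.

Lemma cplx_sub p w I : I \in cplx p w -> I \subset p.
Proof. by case/cplxP => F [IF Fp _]; apply: subset_trans Fp. Qed.

Lemma size_word p F : uniq p -> F \subset p -> size (word p F) + #|F| = size p.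
Proof.
move=> up /subsetP Fp; rewrite size_map size_filter.
rewrite -(count_predC [in F] p) addnC; congr (_ + _).
rewrite -size_filter -(card_uniqP (filter_uniq _ up)); apply: eq_card => x.
by rewrite mem_filter; case xF: (x \in F) => //=; rewrite Fp.
Qed.

(** A facet leaves exactly a reduced word for [w], so its size is determined. *)
Lemma cplx_pure p w : uniq p -> pure_card (cplx p w) (size p - len hS w).
Proof.
move=> up J /cplxP[F [JF Fp rF]]; have sz := size_word up Fp.
have /reducedP[_ _ sw] := rF; have cF : #|F| = size p - len hS w by lia.
split; first by rewrite -cF subset_leq_card.
by exists F; split => //; apply/cplxP; exists F.
Qed.

Lemma facet_cplx p w F : uniq p ->
  facet (cplx p w) F = (F \subset p) && reduced hS (word p F) w.
Proof.
move=> up; rewrite (facet_card _ (cplx_pure up)); apply/andP/andP.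
  case=> /cplxP[G [FG Gp rG]] /eqP cF; suff -> : F = G by [].
  apply/eqP; rewrite eqEcard FG cF; have := size_word up Gp.
  by have /reducedP[_ _ ->] := rG; lia.
case=> Fp rF; split; first by apply/cplxP; exists F.
by have := size_word up Fp; have /reducedP[_ _ ->] := rF; lia.
Qed.

Lemma word_rcons p v F :
  word (rcons p v) F = if v \in F then word p F else rcons (word p F) (q v).
Proof. by rewrite /word filter_rcons; case: (v \in F); rewrite /= ?map_rcons. Qed.

Lemma eq_word p F G : {in p, forall x, (x \in F) = (x \in G)} -> word p F = word p G.
Proof. by move=> h; congr map; apply: eq_in_filter => x /h ->. Qed.

Lemma word_setD1 p v F : v \notin p -> word p (F :\ v) = word p F.
Proof.
by move=> vp; apply: eq_word => x xp; rewrite !inE; case: eqP xp vp => // -> ->.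
Qed.

Lemma word_setU1 p v F : v \notin p -> word p (v |: F) = word p F.
Proof.
by move=> vp; apply: eq_word => x xp; rewrite !inE; case: eqP xp vp => // -> ->.
Qed.

Lemma word_delete p F u1 a u2 : uniq p -> word p F = u1 ++ a :: u2 ->
  exists2 x, x \in p & word p (x |: F) = u1 ++ u2.
Proof.
move=> up; rewrite /word; set l := [seq x <- p | x \notin F] => e.
have ul : uniq l by apply: filter_uniq.
have e1 : map q (take (size u1) l) = u1 by rewrite map_take e take_size_cat.
case e2 : (drop (size u1) l) => [|x l2].
  by have := congr1 (map q) e2; rewrite map_drop e drop_size_cat.
have e3 : map q l2 = u2.
  by have := congr1 (map q) e2; rewrite map_drop e drop_size_cat //= => -[].
set l1 := take _ _ in e1; have lE : l = l1 ++ x :: l2 by rewrite -e2 cat_take_drop.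
exists x.
  have : x \in l by rewrite lE mem_cat inE eqxx orbT.
  by rewrite mem_filter => /andP[].
rewrite -e1 -e3 -map_cat; congr map.
have -> : [seq y <- p | y \notin x |: F] = [seq y <- l | y != x].
  by rewrite -filter_predI; apply: eq_filter => y; rewrite /= !inE negb_or.
move: ul; rewrite lE cat_uniq /= => /and3P[_ /norP[n1 _] /andP[n2 _]].
have keep r : x \notin r -> [seq y <- r | y != x] = r.
  move=> nr; apply/all_filterP/allP => y yr.
  by apply: contraNneq nr => <-.
by rewrite filter_cat /= eqxx /= !keep.
Qed.

Section LastLetter.
Variables (p : seq V) (v : V).
Hypotheses (up : uniq p) (vp : v \notin p) (Sv : q v \in S).

Let notinp F : F \subset p -> v \notin F.
Proof. by move=> /subsetP h; apply: contra vp => /h. Qed.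

Let sub_rcons F : (F \subset rcons p v) = (F :\ v \subset p).
Proof.
apply/subsetP/subsetP => h x.
  by rewrite !inE => /andP[xv /h]; rewrite mem_rcons inE (negPf xv).
move=> xF; rewrite mem_rcons inE; case: eqP => //= /eqP xv.
by apply: h; rewrite !inE xv.
Qed.

Lemma cplx_rcons_in w I : v \in I ->
  (I \in cplx (rcons p v) w) = (I :\ v \in cplx p w).
Proof.
move=> vI; apply/cplxP/cplxP => -[F [IF Fp rF]].
  have vF : v \in F by apply: (subsetP IF).
  exists (F :\ v); rewrite setSD // -sub_rcons Fp word_setD1 //.
  by rewrite word_rcons vF in rF.
exists (v |: F); rewrite -subDset IF sub_rcons setU1K ?notinp //.
by rewrite word_rcons setU11 word_setU1.
Qed.

Lemma cplx_rcons_up w I : v \notin I -> len hS w < len hS (w * q v) ->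
  (I \in cplx (rcons p v) w) = (I \in cplx p w).
Proof.
move=> vI lt; apply/cplxP/cplxP => -[F [IF Fp rF]].
  rewrite word_rcons in rF; case vF : (v \in F) rF => rF; last first.
    by move: rF; rewrite reduced_rcons // => /andP[_]; lia.
  exists (F :\ v); rewrite -sub_rcons Fp word_setD1 //; split => //.
  by rewrite subsetD1 IF.
exists (v |: F); rewrite subsetU ?IF ?orbT // sub_rcons setU1K ?notinp //.
by rewrite word_rcons setU11 word_setU1.
Qed.

(** A reduced word for [w] that is found before the last letter can be shortened
    by one letter, to a word for [w * q v], since [q v] is a descent of [w]. *)
Lemma cplx_rcons_down w I : v \notin I -> len hS (w * q v) < len hS w ->
  (I \in cplx (rcons p v) w) = (I \in cplx p (w * q v)).
Proof.
move=> vI lt; apply/cplxP/cplxP => -[F [IF Fp rF]].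
  have IFv : I \subset F :\ v by rewrite subsetD1 IF.
  rewrite sub_rcons in Fp.
  rewrite word_rcons in rF; case vF : (v \in F) rF => rF; last first.
    exists (F :\ v); split => //; rewrite word_setD1 //.
    by move: rF; rewrite reduced_rcons // => /andP[].
  have [u1 [a [u2 [e r]]]] := reduced_exchange Sv rF lt.
  rewrite -(word_setD1 F vp) in e; have [x xp e2] := word_delete up e.
  exists (x |: (F :\ v)); rewrite e2 subsetU ?IFv ?orbT //; split => //.
  by apply/subsetP => y; rewrite in_setU1 => /orP[/eqP->|/(subsetP Fp)].
exists F; split => //.
  by rewrite sub_rcons; apply: subset_trans (subD1set _ _) Fp.
by rewrite word_rcons (negPf (notinp Fp)) reduced_rcons // rF.
Qed.

Lemma cplx_rcons_cone w : len hS w < len hS (w * q v) ->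
  cplx (rcons p v) w = join [set v] (cplx p w).
Proof.
move=> lt; apply/setP => I; rewrite in_join; have [vI|vI] := boolP (v \in I).
  exact: cplx_rcons_in.
rewrite cplx_rcons_up //; have -> // : I :\ v = I.
by apply/setDidPl; rewrite disjoint_sym disjoints1.
Qed.

Lemma link_cplx_rcons w : link (cplx (rcons p v) w) [set v] = cplx p w.
Proof.
have E J : v \notin J -> (v |: J \in cplx (rcons p v) w) = (J \in cplx p w).
  by move=> vJ; rewrite cplx_rcons_in ?setU11 // setU1K.
apply/setP => J; rewrite in_link1; apply/and3P/idP => [[_ + vJ]|JL].
  by rewrite E.
have vJ := notinp (cplx_sub JL).
by rewrite E // JL vJ; split => //; apply: (@cplx_closed _ w _ (v |: J)); rewrite ?E // subsetUr.
Qed.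

Lemma del_cplx_rcons w : len hS (w * q v) < len hS w ->
  del (cplx (rcons p v) w) [set v] = cplx p (w * q v).
Proof.
move=> lt; apply/setP => J; rewrite in_del1; apply/andP/idP => [[+ vJ]|JB].
  by rewrite cplx_rcons_down.
by have vJ := notinp (cplx_sub JB); rewrite cplx_rcons_down.
Qed.

Lemma cplx_avoids w : avoids (cplx p w) [set v].
Proof. by move=> J /cplx_sub/notinp; rewrite disjoint_sym disjoints1. Qed.

End LastLetter.

(** The last letter is a vertex whose link and deletion are again subword
    complexes of the shorter word: a reduced word that avoids this letter can be
    exchanged against one that ends in it. *)
Theorem cplx_vd p w : uniq p -> labelled p -> vertex_decomposable (cplx p w).
Proof.
elim/last_ind: p w => [|p v IH] w.
  move=> _ _; apply: VD_simplex.
  have s0 I : I \subset ([::] : seq V) -> I = set0.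
    by move=> h; apply/eqP; rewrite -subset0; apply/subsetP => x /(subsetP h).
  have [h|h] := boolP (set0 \in cplx [::] w).
    right; exists set0; apply/setP => I; rewrite powersetE subset0.
    by apply/idP/eqP => [/cplx_sub/s0|->].
  left; apply/setP => I; rewrite in_set0; apply: contraNF h => h.
  by rewrite -(s0 I (cplx_sub h)).
rewrite rcons_uniq => /andP[vp up] Sp.
have Sv : q v \in S by apply: Sp; rewrite mem_rcons mem_head.
have {}Sp : labelled p by move=> x xp; apply: Sp; rewrite mem_rcons inE xp orbT.
have [lt|lt] := ltnP (len hS w) (len hS (w * q v)).
  by rewrite cplx_rcons_cone //; apply: vd_join; [apply: cplx_avoids|apply: IH].
have {}lt : len hS (w * q v) < len hS w by have := len_mulr hS w Sv; lia.
have [vD|vD] := boolP ([set v] \in cplx (rcons p v) w).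
  apply: (@VD_vertex _ _ v) => //.
  - by apply: pure_card_pure; apply: cplx_pure; rewrite rcons_uniq vp.
  - by rewrite del_cplx_rcons //; apply: IH.
  - by rewrite link_cplx_rcons //; apply: IH.
rewrite (_ : cplx _ _ = cplx p (w * q v)); first exact: IH.
rewrite -del_cplx_rcons //; apply/setP => J; rewrite in_del1.
case JD : (J \in _) => //=; apply/esym; apply: contra vD => vJ.
by apply: cplx_closed JD _; rewrite sub1set.
Qed.

(** The star of [I] is the join of [I] with its link, which is the subword
    complex of the letters outside of [I]. *)
Lemma star_cplx p w I : I \in cplx p w ->
  star (cplx p w) I = join I (cplx [seq v <- p | v \notin I] w).
Proof.
move=> ID; have Ip := cplx_sub ID; apply/setP => J; rewrite inE in_join.
have wE F : I \subset F -> word [seq v <- p | v \notin I] (F :\: I) = word p F.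
  move=> /subsetP IF; rewrite /word -filter_predI; congr map; apply: eq_filter => x /=.
  rewrite !inE negb_and negbK; case xI : (x \in I) => /=; last by rewrite andbT.
  by rewrite IF.
apply/andP/cplxP => [[_ /cplxP[F [JF Fp rF]]]|[F [JF Fp rF]]].
  move: JF; rewrite subUset => /andP[IF JF]; exists (F :\: I).
  rewrite setSD // wE //; split => //; apply/subsetP => x.
  by rewrite inE mem_filter => /andP[-> /(subsetP Fp)].
have dF : [disjoint F & I].
  rewrite disjoint_subset; apply/subsetP => x /(subsetP Fp).
  by rewrite mem_filter inE => /andP[].
suff h : I :|: J \in cplx p w.
  by split => //; apply: cplx_closed h (subsetUr _ _).
apply/cplxP; exists (I :|: F); split.
- by rewrite subUset subsetUl -subDset.
- apply/subsetP => x; rewrite in_setU => /orP[/(subsetP Ip)//|/(subsetP Fp)].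
  by rewrite mem_filter => /andP[].
- by rewrite -wE ?subsetUl // setDU_disjoint.
Qed.

Lemma star_cplx_vd p w I : uniq p -> labelled p -> I \in cplx p w ->
  vertex_decomposable (star (cplx p w) I).
Proof.
move=> up Sp ID; rewrite star_cplx //; apply: vd_join.
  move=> J /cplx_sub /subsetP h; rewrite disjoint_subset; apply/subsetP => x /h.
  by rewrite mem_filter inE => /andP[].
apply: cplx_vd; first exact: filter_uniq.
by move=> x; rewrite mem_filter => /andP[_ /Sp].
Qed.

End Labelled.

Section Rotation.
Variable V : finType.
Implicit Types (p : seq V) (q : V -> W) (F G I J : {set V}) (v : V).

(** A word [s :: u] is reduced for [w0] exactly when [rcons u (s ^ w0)] is, so
    relabelling the first position and moving it to the end keeps the facets. *)
Lemma cplx_rotate1 q v p : uniq (v :: p) -> labelled q (v :: p) ->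
  exists2 q', labelled q' (rcons p v) &
    cplx q' (rcons p v) (w0 hS) = cplx q (v :: p) (w0 hS).
Proof.
move=> /andP[vp up] Sp; set q' := fun x => if x == v then q v ^ w0 hS else q x.
have Sv : q v \in S by apply: Sp; rewrite mem_head.
exists q'.
  move=> x; rewrite mem_rcons /q' => xp; case: eqP => _; last exact: Sp.
  exact: gen_conj_w0.
apply/setP => I; rewrite [LHS]inE [RHS]inE; apply: eq_existsb => F /=.
have -> : (F \subset rcons p v) = (F \subset v :: p).
  by apply: eq_subset_r => x; rewrite mem_rcons.
congr [&& _, _ & _].
have -> : word q' (rcons p v) F = if v \in F then word q p F else rcons (word q p F) (q v ^ w0 hS).
  rewrite word_rcons; have -> : word q' p F = word q p F.
    apply/eq_in_map => x; rewrite mem_filter /q' => /andP[_ xp].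
    by case: eqP xp vp => // -> ->.
  by rewrite /q' eqxx.
by rewrite /word /=; case: ifP => //= _; rewrite reduced_rotate.
Qed.

Lemma cplx_rotate q p k : uniq p -> labelled q p ->
  exists2 q', labelled q' (rot k p) & cplx q' (rot k p) (w0 hS) = cplx q p (w0 hS).
Proof.
move=> up Sp; elim: k => [|k [q1 S1 e1]]; first by exists q; rewrite rot0.
have [lt|ge] := ltnP k (size p); last first.
  by rewrite rot_oversize ?(leqW ge) // -(rot_oversize ge); exists q1; rewrite // rot_oversize in e1 *.
rewrite rotS // -e1; have : size (rot k p) = size p by rewrite size_rot.
have : uniq (rot k p) by rewrite rot_uniq.
case: (rot k p) S1 => [|v p'] S1 ur sz; first by rewrite -sz in lt.
by rewrite rot1_cons; apply: cplx_rotate1.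
Qed.

Lemma cplx_rotate_to q p v : uniq p -> labelled q p -> v \in p ->
  exists p' q', [/\ uniq (rcons p' v), labelled q' (rcons p' v),
    size p = (size p').+1 & cplx q' (rcons p' v) (w0 hS) = cplx q p (w0 hS)].
Proof.
move=> up Sp /rot_to[i p' e]; have [q1 S1 e1] := cplx_rotate i up Sp.
have ur : uniq (v :: p') by rewrite -e rot_uniq.
rewrite e in S1 e1; have [q2 S2 e2] := cplx_rotate1 ur S1.
exists p', q2; split => //; last by rewrite e2.
  by rewrite rcons_uniq.
by rewrite -(size_rot i) e.
Qed.

Section LastLetterCostar.
Variables (q : V -> W) (p : seq V) (v : V) (I : {set V}).
Hypotheses (up : uniq p) (vp : v \notin p) (Sv : q v \in S) (vI : v \in I).
Let D := cplx q (rcons p v) (w0 hS).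

Let upv : uniq (rcons p v). Proof. by rewrite rcons_uniq vp. Qed.

Let w0_descent : len hS (w0 hS * q v) < len hS (w0 hS).
Proof.
have [h|h] := len_mulr hS (w0 hS) Sv; last by rewrite [X in _ < X]h.
by have := len_w0_max hS (w0 hS * q v); rewrite h ltnn.
Qed.

Lemma costar_pure : pure_card (costar D I) ((size p).+1 - len hS (w0 hS)).
Proof.
have pD := @cplx_pure _ q _ (w0 hS) upv; rewrite size_rcons in pD.
move=> J /costarP[JD [F [fF nF JF]]]; split; first by have [] := pD J JD.
move: (fF); rewrite (facet_card _ pD) => /andP[FD /eqP cF].
by exists F; split => //; apply/costarP; split => //; exists F.
Qed.

Lemma del_costar : del (costar D I) [set v] = cplx q p (w0 hS * q v).
Proof.
rewrite -del_cplx_rcons //; apply/setP => J; rewrite !in_del1.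
case vJ : (v \in J); rewrite ?andbF ?andbT //.
apply/costarP/idP => [[]//|JD]; split => //.
move: (JD); rewrite cplx_rcons_down ?vJ // => /cplxP[F [JF Fp rF]].
have vF : v \notin F by apply: contra vp; apply/subsetP.
exists F; split => //; last by apply: contra vF => /subsetP; apply.
rewrite facet_cplx // word_rcons (negPf vF) reduced_rcons // rF w0_descent !andbT.
by apply: subset_trans Fp _; apply/subsetP => x xp; rewrite mem_rcons inE xp orbT.
Qed.

Lemma link_costar : link (costar D I) [set v] = costar (cplx q p (w0 hS)) (I :\ v).
Proof.
have cc : down_closed (costar D I) by apply: costar_closed; apply: cplx_closed.
have fE F : v \in F -> facet D F = facet (cplx q p (w0 hS)) (F :\ v).
  move=> vF; rewrite !facet_cplx // word_rcons vF word_setD1 //; congr (_ && _).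
  apply/subsetP/subsetP => h x.
    by rewrite !inE => /andP[xv /h]; rewrite mem_rcons inE (negPf xv).
  move=> xF; rewrite mem_rcons inE; case: eqP => //= /eqP xv.
  by apply: h; rewrite !inE xv.
apply/setP => J; rewrite in_link1; apply/and3P/idP.
  case=> _ /costarP[vJD [F [fF nF vJF]]] vJ.
  have vF : v \in F by apply: (subsetP vJF); rewrite setU11.
  apply/costarP; split.
    by move: vJD; rewrite cplx_rcons_in ?setU11 // setU1K.
  exists (F :\ v); rewrite -fE //; split => //.
    by apply: contra nF; rewrite subDset setD1K.
  by rewrite -(setU1K vJ) setSD.
move=> /costarP[JL [F [fF nF JF]]].
have vJ : v \notin J by apply: contra vp; apply/subsetP; apply: cplx_sub JL.
have vF : v \notin F.
  by case/facetP: fF => /cplx_sub/subsetP h _; apply: contra vp => /h.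
have vJc : v |: J \in costar D I.
  apply/costarP; split; first by rewrite cplx_rcons_in ?setU11 // setU1K.
  exists (v |: F); rewrite fE ?setU11 // setU1K // setUS //; split => //.
  by rewrite -subDset.
by split => //; apply: cc vJc (subsetUr _ _).
Qed.

End LastLetterCostar.

(** For the longest element the word may be rotated, so that any vertex of [I]
    can be made the last letter [v].  Every facet that avoids [v] fails to
    contain [I]; hence the deletion of [v] from the costar is the whole deletion
    of [v] from the complex, and its link is a costar for the shorter word. *)
Theorem costar_w0_vd q p I : uniq p -> labelled q p -> I \in cplx q p (w0 hS) ->
  vertex_decomposable (costar (cplx q p (w0 hS)) I).
Proof.
have [n] := ubnP (size p); elim: n => // n IH in q p I *.
rewrite ltnS => le up Sp ID; have [I0|[v vI]] := set_0Vmem I.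
  apply: VD_simplex; left; apply/eqP; rewrite -subset0; apply/subsetP => J.
  by move=> /costarP[_ [F [_ + _]]]; rewrite I0 sub0set.
have vp : v \in p by apply: (subsetP (cplx_sub ID)).
have [p' [q' [up' Sp' sz e]]] := cplx_rotate_to up Sp vp.
rewrite -e in ID *; have uv := up'; rewrite rcons_uniq in uv.
have {up' uv} [vp' up'] : v \notin p' /\ uniq p' by apply/andP.
have Sv : q' v \in S by apply: Sp'; rewrite mem_rcons mem_head.
have {}Sp' : labelled q' p' by move=> x xp; apply: Sp'; rewrite mem_rcons inE xp orbT.
have vdd : vertex_decomposable (del (costar (cplx q' (rcons p' v) (w0 hS)) I) [set v]).
  by rewrite del_costar //; apply: cplx_vd.
set C := costar _ I in vdd *.
have [vC|vC] := boolP ([set v] \in C).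
  apply: (@VD_vertex _ _ v) => //.
    by apply: pure_card_pure; apply: costar_pure.
  rewrite link_costar //; apply: IH => //; first lia.
  by rewrite -cplx_rcons_in.
rewrite (_ : C = del C [set v]) //; apply/setP => J; rewrite in_del1.
case JC : (J \in C) => //=; apply/esym; apply: contra vC => vJ.
by apply: (costar_closed (@cplx_closed _ _ _ _)) JC _; rewrite sub1set.
Qed.

End Rotation.

(** Appending a reduced word for [w^-1 * w0] reduces to the longest element.
    When the Demazure product of the word is [w], all the appended letters are
    needed to reach the length of [w0], so they are vertices of no face and the
    complex is the same. *)
Theorem costar_dem_vd (V : finType) (q : V -> W) (p : seq V) (w : W) I :
  uniq p -> labelled q p -> dem hS [seq q v | v <- p] = w ->
  I \in cplx q p w -> vertex_decomposable (costar (cplx q p w) I).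
Proof.
move=> up Sp dw ID.
have [u /reducedP[Su uw su]] := reduced_exists hS (w^-1 * w0 hS).
have lw : (len hS w + size u)%N = len hS (w0 hS) by rewrite su addnC len_w0V.
(* [V'] adds the positions of the appended letters, listed by [g]. *)
pose V' : finType := (V + 'I_(size u))%type.
pose q' (x : V') := match x with inl a => q a | inr j => nth 1 u j end.
pose g : seq V' := [seq inr j | j <- enum 'I_(size u)].
pose p' : seq V' := [seq inl a | a <- p] ++ g.
have inlI : injective (inl : V -> V') by move=> x y [].
have inrI : injective (inr : 'I_(size u) -> V') by move=> x y [].
have up' : uniq p'.
  rewrite /p' /g cat_uniq !map_inj_uniq // up -enumT enum_uniq andbT /=.
  by apply/hasPn => _ /mapP[j _ ->]; apply/mapP => -[].
have Sp' : labelled q' p'.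
  move=> x; rewrite mem_cat => /orP[] /mapP[y yp ->] /=; first exact: Sp.
  by apply: (allP Su); rewrite mem_nth.
have Sqp : word_in S [seq q v | v <- p] by apply/allP => _ /mapP[x xp ->]; apply: Sp.
have gE (F : {set V'}) : word q' g F = [seq nth 1 u j | j : 'I_(size u) <- enum 'I_(size u) & inr j \notin F].
  by rewrite /word filter_map -map_comp.
have p'E (F : {set V'}) : word q' p' F = word q p [set x | inl x \in F] ++ word q' g F.
  rewrite /word filter_cat map_cat filter_map -map_comp; congr (map _ _ ++ _).
  by apply: eq_filter => x; rewrite /= inE.
have sup : supported (inl : V -> V') (cplx q' p' (w0 hS)).
  move=> K /cplxP[F [KF Fp rF]]; apply/subsetP => -[x _|j jK].
    by apply/imsetP; exists x; rewrite ?inE.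
  have jF := subsetP KF _ jK.
  have szg : size (word q' g F) < size u.
    rewrite gE size_map size_filter -[X in _ < X](size_enum_ord).
    rewrite -(count_predC (fun j : 'I_(size u) => inr j \notin F)).
    rewrite -ltn_subLR // subnn -has_count.
    by apply/hasP; exists j; rewrite ?mem_enum //= jF.
  have Sg : word_in S (word q' g F).
    apply/allP => _ /mapP[x + ->]; rewrite mem_filter => /andP[_ xg].
    by apply: Sp'; rewrite mem_cat xg orbT.
  suff : ~~ reduced hS (word q' p' F) (w0 hS) by rewrite rF.
  apply: (dem_no_w0 Sqp Sg); first by rewrite dw -lw ltn_add2l.
  by rewrite p'E cat_subseq //; apply/map_subseq/filter_subseq.
have nog (F : {set V'}) : F \subset [set inl x | x in [set: V]] -> word q' g F = u.
  move=> /subsetP h; rewrite gE (eq_filter (a2 := predT)); last first.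
    by move=> j; apply/negP => /h /imsetP[].
  by rewrite filter_predT -[RHS]take_size -(map_nth_iota0 1 (leqnn _)) -val_enum_ord -map_comp.
have pE : cplx q p w = pullback (inl : V -> V') (cplx q' p' (w0 hS)).
  apply/setP => J; rewrite [RHS]inE; apply/cplxP/cplxP => -[F [JF Fp rF]].
    have F1 : [set x | inl x \in (inl : V -> V') @: F] = F.
      by apply/setP => x; rewrite inE mem_imset.
    exists ((inl : V -> V') @: F); rewrite sub_imset_inj //; split => //.
      apply/subsetP => _ /imsetP[x xF ->]; rewrite mem_cat map_f //.
      exact: (subsetP Fp).
    rewrite p'E F1 nog ?imsetS ?subsetT //.
    have /reducedP[SF eF sF] := rF; apply/reducedP; split.
    - by rewrite /word_in all_cat; apply/andP.
    - by rewrite word_prod_cat eF uw mulKVg.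
    - by rewrite size_cat sF.
  have FD : F \in cplx q' p' (w0 hS) by apply/cplxP; exists F.
  have FE := supportedP sup FD; exists (inl @^-1: F); split.
  - by rewrite -sub_imset_pre.
  - apply/subsetP => x; rewrite inE => /(subsetP Fp); rewrite mem_cat => /orP[]/mapP[y yp].
      by move=> [->].
    by [].
  rewrite p'E (nog F (sup F FD)) in rF.
  have -> : word q p (inl @^-1: F) = word q p [set x | inl x \in F].
    by apply: eq_word => x _; rewrite !inE.
  have /reducedP[+ eF sF] := rF; rewrite /word_in all_cat => /andP[SF _].
  apply/reducedP; split => //.
    by apply: (mulIg (w^-1 * w0 hS)); rewrite -uw -word_prod_cat eF uw mulKVg.
  by move: sF; rewrite size_cat; lia.
rewrite pE costar_pullback //; apply: vd_pullback => //.
  by move=> K /costarP[/sup].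
by apply: costar_w0_vd => //; rewrite pE inE in ID.
Qed.

End SubwordComplexes.

(** * Collapses *)

Section Collapses.
Import mathcomp.boot.fintype mathcomp.boot.finset.
Local Open Scope set_scope.
Variable V : finType.
Implicit Types (D X B L : {set {set V}}) (F I J K : {set V}) (u v : V).

Definition elementary_collapse D D1 := exists F u,
  [/\ u \notin F, F \in D, u |: F \in D,
      forall K, K \in D -> F \subset K -> K = F \/ K = u |: F
    & D1 = D :\: [set F; u |: F]].

(** The free face removed by an elementary collapse may be empty, so that a
    simplex collapses to the void complex.  Such a step never occurs on the
    way to a complex that has the empty face. *)
Inductive collapses D0 : {set {set V}} -> Prop :=
| collapses_refl : collapses D0 D0
| collapses_step D D1 : elementary_collapse D D1 -> collapses D0 D1 ->
    collapses D0 D.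

Lemma collapses_trans D2 D1 D : collapses D1 D -> collapses D2 D1 -> collapses D2 D.
Proof.
move=> c c2; elim: c => // {}D D' e _ IH; exact: collapses_step e IH.
Qed.

Lemma collapses_sub D0 D : collapses D0 D -> D0 \subset D.
Proof.
elim=> [|{}D D1 [F [u [_ _ _ _ ->]]] _ IH]; first exact: subxx.
by apply: subset_trans IH (subsetDl _ _).
Qed.

(** The complex with deletion [B] and link [L] at the vertex [v]. *)
Definition mix v B L : {set {set V}} :=
  [set J : {set V} | if v \in J then J :\ v \in L else J \in B].

Lemma in_mix v B L J : (J \in mix v B L) = if v \in J then J :\ v \in L else J \in B.
Proof. by rewrite inE. Qed.

Lemma notin_setD1 v J : v \notin J -> J :\ v = J.
Proof. by move=> vJ; apply/setDidPl; rewrite disjoint_sym disjoints1. Qed.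

Lemma avoids1 D v J : avoids D [set v] -> J \in D -> v \notin J.
Proof. by move=> aD /aD; rewrite disjoint_sym disjoints1. Qed.

Lemma join_mix v X : join [set v] X = mix v X X.
Proof.
apply/setP => J; rewrite in_join in_mix; case: ifP => // /negbT vJ.
by rewrite notin_setD1.
Qed.

(** The faces removed from [B1] are not in [L], so they stay free when faces
    containing [v] are present. *)
Lemma mix_collapses_left v B B1 L : collapses B1 B -> L \subset B1 ->
  avoids B [set v] -> collapses (mix v B1 L) (mix v B L).
Proof.
move=> cB LB1; elim: cB => [|{}B B' [F [u [uF FB uFB max ->]]] cB IH aB].
  by move=> _; apply: collapses_refl.
have vF := avoids1 aB FB; have vuF := avoids1 aB uFB.
have LB : L \subset B :\: [set F; u |: F] := subset_trans LB1 (collapses_sub cB).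
apply: collapses_step (IH _); last first.
  by move=> J; rewrite inE => /andP[_ /aB].
exists F, u; split => //; rewrite ?in_mix ?(negPf vF) ?(negPf vuF) //.
  move=> K; rewrite in_mix; case: ifP => // vK KL FK; last exact: max.
  have := subsetP LB _ KL; rewrite !inE negb_or => /andP[/andP[/eqP n1 /eqP n2] KB].
  by case: (max _ KB) => //; rewrite subsetD1 FK.
apply/setP => J; rewrite in_setD !in_mix in_setD !in_set2.
case vJ : (v \in J); rewrite ?andbT //.
have /negPf -> : J != F by apply: contraNneq vF => <-.
have /negPf -> // : J != u |: F by apply: contraNneq vuF => <-.
Qed.

(** A collapse of the link is performed on the faces that contain [v].  The free
    face [v |: F] is nonempty also when [F] is empty. *)
Lemma mix_collapses_right v B L L1 : collapses L1 L -> avoids L [set v] ->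
  collapses (mix v B L1) (mix v B L).
Proof.
elim=> [|{}L L' [F [u [uF FL uFL max ->]]] cL IH aL].
  by move=> _; apply: collapses_refl.
have vF := avoids1 aL FL; have vuF := avoids1 aL uFL.
have uv : u != v by move: vuF; rewrite !inE negb_or eq_sym => /andP[].
apply: collapses_step (IH _); last first.
  by move=> J; rewrite inE => /andP[_ /aL].
have swap : u |: (v |: F) = v |: (u |: F) by rewrite setUCA.
exists (v |: F), u; split => //.
- by rewrite !inE negb_or uv.
- by rewrite in_mix setU11 setU1K.
- by rewrite swap in_mix setU11 setU1K.
- move=> K; rewrite in_mix swap => KD FK.
  have vK : v \in K by apply: (subsetP FK); rewrite setU11.
  rewrite vK in KD; have FK' : F \subset K :\ v by rewrite -(setU1K vF) setSD.
  by rewrite -(setD1K vK); case: (max _ KD FK') => ->; [left|right].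
apply/setP => J; rewrite in_setD !in_mix in_setD swap !in_set2.
case vJ : (v \in J); last first.
  have /negPf -> : J != v |: F by apply: contraFneq vJ => ->; rewrite setU11.
  by have /negPf -> // : J != v |: (u |: F) by apply: contraFneq vJ => ->; rewrite setU11.
have E (G : {set V}) : v \notin G -> (J :\ v == G) = (J == v |: G).
  by move=> vG; apply/eqP/eqP => [<-|->]; rewrite ?setD1K ?setU1K.
by rewrite !E.
Qed.

(** A maximal face [F] of [X] outside of [L] is free in the cone, below the face
    [v |: F] only. *)
Lemma join_collapses v X L : down_closed X -> down_closed L -> L \subset X ->
  avoids X [set v] -> collapses (join [set v] L) (join [set v] X).
Proof.
have [n] := ubnP #|X :\: L|; elim: n => // n IH in X *.
rewrite ltnS => le cX cL LX aX; have [D0|[F0 F0D]] := set_0Vmem (X :\: L).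
  have -> : X = L by apply/eqP; rewrite eqEsubset LX -setD_eq0 D0 eqxx.
  exact: collapses_refl.
case: (@arg_maxnP _ F0 [in X :\: L] (fun F : {set V} => #|F|) F0D) => F FD maxF.
have [FL FX] : F \notin L /\ F \in X by move: FD; rewrite /= inE => /andP[].
have vF := avoids1 aX FX.
have maxF' K : K \in X -> F \subset K -> K = F.
  move=> KX FK; apply/esym/eqP; rewrite eqEcard FK /=.
  by apply: maxF; rewrite /= inE KX andbT; apply: contra FL => KL; apply: cL FK.
have sX : X :\ F \subset X by apply: subD1set.
apply: (@collapses_step _ _ (join [set v] (X :\ F))); last first.
  apply: IH => //.
  - apply: leq_trans le; apply: proper_card; apply/properP; split.
      exact: setSD.
    by exists F; rewrite !in_setD ?in_set1 ?FL ?FX ?eqxx.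
  - move=> J K; rewrite !inE => /andP[KF KX] JK; rewrite (cX _ _ KX JK) andbT.
    by apply: contraNneq KF => JF; rewrite (maxF' K) // -JF.
  - apply/subsetP => J JL; rewrite !inE (subsetP LX) // andbT.
    by apply: contraNneq FL => <-.
  - by move=> J /(subsetP sX)/aX.
exists F, v; split => //; rewrite ?in_join ?setU1K ?notin_setD1 //.
  move=> K; rewrite in_join => KX FK.
  have := maxF' _ KX; rewrite subsetD1 FK vF => /(_ isT) KE.
  have [vK|vK] := boolP (v \in K); last by left; rewrite -KE notin_setD1.
  by right; rewrite -KE setD1K.
apply/setP => J; rewrite in_join in_setD in_join in_setD1 !in_set2; congr (~~ _ && _).
have [vJ|vJ] := boolP (v \in J).
  have /negPf -> : J != F by apply: contraNneq vF => <-.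
  by apply/eqP/eqP => [<-|->]; rewrite ?setD1K ?setU1K.
rewrite notin_setD1 //; have /negPf -> : J != v |: F by apply: contraNneq vJ => ->; rewrite setU11.
by rewrite orbF.
Qed.

Lemma mix_collapses v X B L : L \subset B -> avoids X [set v] ->
  collapses B X -> collapses L X -> collapses (mix v B L) (join [set v] X).
Proof.
move=> LB aX cB cL; rewrite join_mix.
apply: collapses_trans (mix_collapses_right _ cL aX) _.
exact: mix_collapses_left.
Qed.

End Collapses.

Section SubwordCollapse.
Import mathcomp.boot.fintype mathcomp.boot.finset.
Local Open Scope set_scope.
Local Open Scope group_scope.
Variables (W : finGroupType) (S : {set W}) (hS : coxeter_system S).
Variables (V : finType) (q : V -> W).
Implicit Types (p : seq V) (w : W).

(** If the last letter [s] is a descent of [w], then [w] and [w * s] are both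
    different from the Demazure product of the shorter word, and the collapses
    onto link and deletion combine.  Otherwise the complex is a cone. *)
Theorem cplx_collapses p w : uniq p -> labelled S q p -> p != [::] ->
  dem hS [seq q v | v <- p] != w ->
  collapses (cplx hS q p w) (powerset [set x in p]).
Proof.
elim/last_ind: p w => // p v IH w.
rewrite rcons_uniq => /andP[vp up] Sp _.
have Sv : q v \in S by apply: Sp; rewrite mem_rcons mem_head.
have {}Sp : labelled S q p by move=> x xp; apply: Sp; rewrite mem_rcons inE xp orbT.
rewrite map_rcons dem_rcons => dw.
have -> : powerset [set x in rcons p v] = join [set v] (powerset [set x in p]).
  rewrite join_powerset; congr powerset; apply/setP => x.
  by rewrite !inE mem_rcons inE.
have pX J : J \in powerset [set x in p] -> J \subset p.
  by rewrite inE => /subsetP h; apply/subsetP => x /h; rewrite inE.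
have cX : down_closed (powerset [set x in p]).
  by move=> J K; rewrite !inE => KX JK; apply: subset_trans KX.
have aX : avoids (powerset [set x in p]) [set v].
  by move=> J /pX/subsetP h; rewrite disjoint_sym disjoints1; apply: contra vp => /h.
have LX w' : cplx hS q p w' \subset powerset [set x in p].
  apply/subsetP => J /cplx_sub/subsetP h; rewrite inE; apply/subsetP => x /h.
  by rewrite inE.
have [lt|lt] := ltnP (len hS w) (len hS (w * q v)).
  rewrite (cplx_rcons_cone up vp Sv lt).
  by apply: join_collapses => //; apply: cplx_closed.
have {}lt : len hS (w * q v) < len hS w by have := len_mulr hS w Sv; lia.
have wss : w * q v * q v = w by rewrite -mulgA (gen_sq hS Sv) mulg1.
have d1 : dem hS [seq q x | x <- p] != w.
  by apply: contraNneq dw => ->; rewrite /dem_right ltnNge (ltnW lt).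
have d2 : dem hS [seq q x | x <- p] != w * q v.
  by apply: contraNneq dw => ->; rewrite /dem_right wss lt.
have -> : cplx hS q (rcons p v) w = mix v (cplx hS q p (w * q v)) (cplx hS q p w).
  apply/setP => J; rewrite in_mix; case: ifP => [vJ|/negbT vJ].
    exact: cplx_rcons_in.
  exact: cplx_rcons_down.
have [p0|p0] := eqVneq p [::].
  have v0 w' : dem hS [seq q x | x <- p] != w' -> cplx hS q p w' = set0.
    rewrite p0 => dw'; apply/setP => J; rewrite in_set0; apply/negP => /cplxP[F [_ _]].
    by case/reducedP => _ /esym h; move: dw'; rewrite h word_prod_nil eqxx.
  rewrite !v0 // -join_mix; apply: join_collapses => //.
    by move=> J K; rewrite inE.
  exact: sub0set.
apply: mix_collapses => //; try exact: IH.
apply/subsetP => J JL; have vJ : v \notin J.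
  by apply: contra vp; apply/subsetP; apply: cplx_sub JL.
rewrite -(cplx_rcons_down up vp Sv vJ lt).
apply: (@cplx_closed _ _ _ _ _ _ _ _ (v |: J)); last exact: subsetUr.
by rewrite cplx_rcons_in ?setU11 // setU1K.
Qed.

End SubwordCollapse.

(** * A parity lemma for linear orders *)

(** Scarf's lemma.  Each order [i] is given by an injective rank function; the
    dummy [dm i] is the least element for the order [i] and lies above all
    other elements, except dummies, for the other orders.  Dominant sets with
    as many elements as there are orders play the role of the simplices of a
    triangulation, and the dummies that of the corners of the big simplex.  There
    are at least two orders, so that a set with one element less is nonempty. *)
Section Scarf.
Import mathcomp.boot.fintype mathcomp.boot.finset.
Local Open Scope set_scope.
Variables (m : nat) (T : finType) (rk : 'I_m.+2 -> T -> nat) (dm : 'I_m.+2 -> T).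
Variables (c : T -> 'I_m.+2) (x0 : T).
Hypothesis rk_inj : forall i, injective (rk i).
Hypothesis dm_min : forall i x, x != dm i -> rk i (dm i) < rk i x.
Hypothesis dm_max : forall i j x, i != j -> (forall k, x != dm k) ->
  rk i x < rk i (dm j).
Hypothesis x0_real : forall k, x0 != dm k.
Hypothesis c_dm : forall i, c (dm i) = i.
Implicit Types (A B : {set T}) (x y a b : T) (i j k l : 'I_m.+2).
Local Notation n := m.+2.

Definition dominant A : bool := [forall x, exists i, forall (a | a \in A), rk i x <= rk i a].

Lemma dominantP A :
  reflect (forall x, exists i, forall a, a \in A -> rk i x <= rk i a) (dominant A).
Proof.
apply: (iffP forallP) => h x.
  by have /existsP[i /forall_inP hi] := h x; exists i.
by have [i hi] := h x; apply/existsP; exists i; apply/forall_inP.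
Qed.

Lemma dominantS A B : A \subset B -> dominant B -> dominant A.
Proof.
move=> /subsetP AB /dominantP dB; apply/dominantP => x.
by have [i h] := dB x; exists i => a /AB; apply: h.
Qed.

Definition least i A : T := [arg min_(x < odflt x0 [pick x in A] in A) rk i x].

Lemma leastP i A : A != set0 ->
  least i A \in A /\ forall a, a \in A -> rk i (least i A) <= rk i a.
Proof.
move=> /set0Pn[a0 aA]; rewrite /least.
have h : odflt x0 [pick x in A] \in A by case: pickP => // /(_ a0); rewrite aA.
by case: arg_minnP.
Qed.

Lemma least_eq i A a : a \in A -> (forall b, b \in A -> rk i a <= rk i b) ->
  least i A = a.
Proof.
move=> aA h; have [|lA lm] := @leastP i A; first by apply/set0Pn; exists a.
by apply: (@rk_inj i); apply/eqP; rewrite eqn_leq lm ?h.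
Qed.

Lemma dominant_least A a : dominant A -> a \in A -> exists i, least i A = a.
Proof. by move=> /dominantP/(_ a)[i h] aA; exists i; apply: least_eq. Qed.

Lemma dominant_least_set A : dominant A -> A != set0 ->
  [set least i A | i : 'I_n] = A.
Proof.
move=> dA A0; apply/setP => a; apply/imsetP/idP => [[i _ ->]|aA].
  by have [] := leastP i A0.
by have [i <-] := dominant_least dA aA; exists i.
Qed.

(** The elements that dominate [B] for all orders but [k]: those of highest rank
    for [k] among them can be added to [B] in place of the order [k]. *)
Definition above k B : {set T} :=
  [set x | [forall (l | l != k), rk l (least l B) < rk l x]].

Lemma aboveP k B x :
  reflect (forall l, l != k -> rk l (least l B) < rk l x) (x \in above k B).
Proof. by rewrite inE; apply: (iffP forall_inP). Qed.

Lemma above_disjoint B i j x : dominant B -> B != set0 -> i != j ->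
  x \in above i B -> x \in above j B -> False.
Proof.
move=> /dominantP/(_ x)[l h] B0 ij /aboveP hi /aboveP hj.
have [lB _] := leastP l B0; have := h _ lB; rewrite leqNgt => /negP[].
have [->|lj] := eqVneq l j; last exact: hj.
by apply: hi; rewrite eq_sym.
Qed.

Section Door.
Variable B : {set T}.
Hypotheses (dB : dominant B) (B0 : B != set0) (cB : #|B| = m.+1).

(** There are more orders than elements, and the elements of a dominant set are
    the least ones for the orders. *)
Lemma repeated_least : exists i j, i != j /\ least i B = least j B.
Proof.
have [/injectiveP inj|/injectivePn[i [j ij e]]] :=
    boolP (injectiveb (fun i => least i B)); last by exists i, j.
have e : [set least i B | i in predT] = B.
  by rewrite -[RHS](dominant_least_set dB B0); apply: eq_imset.
have := card_imset predT inj; rewrite e cB cardT size_enum_ord => /eqP.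
by rewrite eqn_leq ltnn andbF.
Qed.

Variables (i j : 'I_n).
Hypotheses (ij : i != j) (lij : least i B = least j B).

Lemma least_other k b : k \in [:: i; j] -> b \in B -> exists2 l, l != k & least l B = b.
Proof.
move=> kij bB; have [l e] := dominant_least dB bB.
have [lk|lk] := eqVneq l k; last by exists l.
move: kij; rewrite !inE => /orP[]/eqP kE.
  by exists j; [rewrite kE eq_sym|rewrite -lij -kE -lk].
by exists i; [rewrite kE|rewrite lij -kE -lk].
Qed.

Lemma least_inj A : dominant A -> #|A| = n -> injective (fun l => least l A).
Proof.
move=> dA cA; have A0 : A != set0 by rewrite -card_gt0 cA.
have /imset_injP h : #|[set least l A | l in [set: 'I_n]]| == #|[set: 'I_n]|.
  have -> : [set least l A | l in [set: 'I_n]] = A.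
    rewrite -[RHS](dominant_least_set dA A0).
    by apply/setP => a; apply/imsetP/imsetP => -[l _ ->]; exists l; rewrite ?inE.
  by rewrite cardsT card_ord cA.
by move=> k l; apply: h; rewrite inE.
Qed.

(** In the larger dominant set every element is least for exactly one order.
    Adding [x] must therefore resolve the coincidence of the orders [i] and [j],
    by taking over one of them. *)
Lemma door_cell_above x : x \notin B -> dominant (x |: B) ->
  exists2 k, k \in [:: i; j] & x \in above k B /\
    forall y, y \in above k B -> rk k y <= rk k x.
Proof.
move=> xB dA; have A0 : x |: B != set0 by apply/set0Pn; exists x; rewrite setU11.
have inj := least_inj dA; rewrite cardsU1 xB cB in inj; have {}inj := inj erefl.
have [k kx] := dominant_least dA (setU11 x B).
have eql l : l != k -> least l (x |: B) = least l B.
  move=> lk; have [lA lm] := leastP l A0; apply/esym/least_eq.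
    move: lA; rewrite in_setU1 => /orP[/eqP e|//].
    by move: lk; rewrite (inj l k) ?eqxx // e.
  by move=> b bB; apply: lm; rewrite inE bB orbT.
have abv : x \in above k B.
  apply/aboveP => l lk; rewrite -eql //; have [_ lm] := leastP l A0.
  rewrite ltn_neqAle lm ?setU11 // andbT; apply: contraNneq lk => /rk_inj e.
  by apply/eqP/inj; rewrite e.
exists k.
  rewrite !inE; apply: contraNT ij; rewrite negb_or => /andP[ki kj].
  by apply/eqP/inj; rewrite !eql // eq_sym.
split => // y /aboveP hy; have /dominantP/(_ y)[l h] := dA.
have [<-|lk] := eqVneq l k; first by apply: h; rewrite setU11.
have [lA _] := leastP l A0; have := h _ lA.
by rewrite eql // leqNgt hy.
Qed.

Lemma above_cell k x : k \in [:: i; j] -> x \in above k B ->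
  (forall y, y \in above k B -> rk k y <= rk k x) ->
  x \notin B /\ dominant (x |: B).
Proof.
move=> kij xk xmax; have /aboveP hx := xk; split.
  apply/negP => xB; have [l lk e] := least_other kij xB.
  by have := hx l lk; rewrite e ltnn.
apply/dominantP => y; have [yk|] := boolP (y \in above k B); last first.
  rewrite inE => /forall_inPn[l lk nl]; exists l => b.
  rewrite -leqNgt in nl; have [_ lm] := leastP l B0.
  rewrite in_setU1 => /orP[/eqP->|/lm]; last exact: leq_trans.
  by apply: leq_trans nl (ltnW (hx l lk)).
have /dominantP/(_ x)[l hl] := dB.
have lk : l = k.
  apply/eqP/negPn/negP => lk; have [lB _] := leastP l B0.
  by have := hx l lk; rewrite ltnNge hl.
rewrite lk in hl; exists k => b; rewrite in_setU1 => /orP[/eqP->|/hl]; first exact: xmax.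
by apply: leq_trans; apply: xmax.
Qed.

Definition top_above k : {set T} :=
  [set x in above k B | [forall (y | y \in above k B), rk k y <= rk k x]].

Lemma card_top_above k : #|top_above k| = (above k B != set0).
Proof.
have [e|[y yk]] := set_0Vmem (above k B).
  by rewrite e eqxx; apply: eq_card0 => x; rewrite inE e in_set0.
case: (@arg_maxnP _ y [in above k B] (rk k) yk) => x /= xk xmax.
have -> : above k B != set0 by apply/set0Pn; exists x.
rewrite -[RHS](cards1 x); apply: eq_card => z; rewrite in_set1.
apply/idP/eqP => [|->].
  rewrite inE => /andP[zk /forall_inP zmax]; apply: (@rk_inj k).
  by apply/eqP; rewrite eqn_leq zmax // xmax.
by rewrite inE xk; apply/forall_inP.
Qed.

(** So a door lies in at most two cells, one for each of the orders [i] and [j]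
    that share their least element. *)
Lemma card_door_cells :
  #|[set x | (x \notin B) && dominant (x |: B)]|
  = (above i B != set0) + (above j B != set0).
Proof.
rewrite -!card_top_above -cardsUI.
have -> : top_above i :&: top_above j = set0.
  apply/eqP; rewrite -subset0; apply/subsetP => x.
  rewrite !inE -!andbA => /and4P[xi _ xj _].
  by case: (@above_disjoint B i j x); rewrite // inE.
rewrite cards0 addn0; apply: eq_card => x; rewrite [LHS]inE in_setU.
apply/andP/orP => [[xB dA]|].
  have [k kij [xk xm]] := door_cell_above xB dA.
  have : x \in top_above k by rewrite inE xk; apply/forall_inP.
  by move: kij; rewrite !inE => /orP[]/eqP <-; [left|right].
case; rewrite inE => /andP[xk /forall_inP xm].
  by apply: (above_cell _ xk xm); rewrite inE eqxx.
by apply: (above_cell _ xk xm); rewrite !inE eqxx orbT.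
Qed.
End Door.

Section Parity.
Variable i0 : 'I_n.

Definition door_colored B : bool := c @: B == ~: [set i0].

Definition dummy_door : {set T} := dm @: ~: [set i0].

Lemma dm_inj : injective dm.
Proof. by move=> i j e; rewrite -(c_dm i) e c_dm. Qed.

Lemma dummy_door_colored : door_colored dummy_door.
Proof.
apply/eqP; rewrite /dummy_door -imset_comp -[RHS]imset_id.
by apply: eq_imset => x /=; rewrite c_dm.
Qed.

Lemma card_dummy_door : #|dummy_door| = m.+1.
Proof. by rewrite card_imset ?cardsC1 ?card_ord //; apply: dm_inj. Qed.

Lemma mem_dummy_door k : (dm k \in dummy_door) = (k != i0).
Proof. by rewrite mem_imset ?inE //; apply: dm_inj. Qed.

Lemma dummy_door_neq0 : dummy_door != set0.
Proof. by rewrite -card_gt0 card_dummy_door. Qed.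

Lemma real_dummy x : (exists k, x = dm k) \/ (forall k, x != dm k).
Proof.
have [/existsP[k /eqP e]|/existsPn h] := boolP [exists k, x == dm k].
  by left; exists k.
by right.
Qed.

Lemma dominant_dummy_door : dominant dummy_door.
Proof.
apply/dominantP => x; have [[k ->]|xr] := real_dummy x.
  exists k => a /imsetP[l _ ->]; have [->//|lk] := eqVneq (dm l) (dm k).
  by apply/ltnW/dm_min.
exists i0 => a /imsetP[l li ->]; apply/ltnW/dm_max => //.
by move: li; rewrite !inE eq_sym.
Qed.

Lemma least_dummy_door k : k != i0 -> least k dummy_door = dm k.
Proof.
move=> ki; apply: least_eq; first by rewrite mem_dummy_door.
move=> b _; have [->//|bk] := eqVneq b (dm k); exact/ltnW/dm_min.
Qed.

Lemma above_i0_dummy_door : x0 \in above i0 dummy_door.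
Proof.
by apply/aboveP => l li; rewrite least_dummy_door //; apply: dm_min.
Qed.

Lemma above_dummy_door k : k != i0 -> least k dummy_door = least i0 dummy_door ->
  above k dummy_door = set0.
Proof.
move=> ki e; apply/eqP; rewrite -subset0; apply/subsetP => x /aboveP h.
have hi : rk i0 (dm k) < rk i0 x.
  by have := h i0; rewrite eq_sym ki -e least_dummy_door // => /(_ isT).
have [[l xl]|xr] := real_dummy x; last first.
  by have := @dm_max i0 k x; rewrite eq_sym ki => /(_ isT xr); rewrite ltnNge ltnW.
have [lk|lk] := eqVneq l k; first by move: hi; rewrite xl lk ltnn.
have [li|li] := eqVneq l i0.
  rewrite xl li in hi; have := @dm_min i0 (dm k).
  by rewrite (inj_eq dm_inj) ki ltnNge (ltnW hi) => /(_ isT).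
by have := h l lk; rewrite least_dummy_door // xl ltnn.
Qed.

(** The door of dummies is on the boundary: some [dm k] in it is least for [i0]
    as well as for [k], and no element can take over the order [k]. *)
Lemma card_dummy_door_cells :
  #|[set x | (x \notin dummy_door) && dominant (x |: dummy_door)]| = 1.
Proof.
have dD := dominant_dummy_door; have D0 := dummy_door_neq0.
have cD := card_dummy_door.
have [i [j [ij e]]] := repeated_least dD D0 cD.
rewrite (card_door_cells dD D0 cD ij e).
have ai : above i0 dummy_door != set0.
  by apply/set0Pn; exists x0; apply: above_i0_dummy_door.
have [ii|ii] := eqVneq i i0.
  by rewrite (@above_dummy_door j) ?eqxx ?ii ?ai // -?ii // eq_sym.
have [ji|ji] := eqVneq j i0.
  by rewrite (@above_dummy_door i) ?eqxx ?ji ?ai // -?ji.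
by move: e ij; rewrite !least_dummy_door // => /dm_inj ->; rewrite eqxx.
Qed.

Lemma dummy_door_unique B : door_colored B -> (forall x, x \in B -> exists k, x = dm k) ->
  B = dummy_door.
Proof.
move=> /eqP cB hB; apply/setP => x; apply/idP/imsetP => [xB|[k ki ->]].
  have [k xk] := hB x xB; exists k => //; rewrite -cB.
  by apply/imsetP; exists x; rewrite // xk c_dm.
move: ki; rewrite -cB => /imsetP[y yB ->]; have [l yl] := hB y yB.
by rewrite yl c_dm -yl.
Qed.

(** Any other colored door contains an element that is not a dummy; then [dm k]
    belongs to [above k B], so both cells exist. *)
Lemma card_door_cells2 B : dominant B -> #|B| = m.+1 -> door_colored B ->
  B != dummy_door ->
  #|[set x | (x \notin B) && dominant (x |: B)]| = 2.
Proof.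
move=> dB cB gB nD; have B0 : B != set0 by rewrite -card_gt0 cB.
have [i [j [ij e]]] := repeated_least dB B0 cB.
rewrite (card_door_cells dB B0 cB ij e).
have [b bB br] : exists2 b, b \in B & forall k, b != dm k.
  have [/exists_inP[b bB /forallP h]|/exists_inPn h] :=
    boolP [exists (b | b \in B), [forall k, b != dm k]]; first by exists b.
  case/eqP: nD; apply: dummy_door_unique => // x /h /forallPn[k /negPn/eqP ->].
  by exists k.
have ne k : above k B != set0.
  apply/set0Pn; exists (dm k); apply/aboveP => l lk.
  have [_ lm] := leastP l B0; apply: leq_ltn_trans (lm _ bB) _.
  exact: dm_max.
by rewrite !ne.
Qed.

Definition cell A : bool := dominant A && (#|A| == n).

(** If removing [a1] leaves all colors but [i0], the color of [a1] is repeated by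
    a single [a2], and removing [a2] is the only other choice. *)
Lemma cell_doors A : cell A -> c @: A != [set: 'I_n] ->
  2 %| #|[set a in A | door_colored (A :\ a)]|.
Proof.
move=> /andP[_ /eqP cA] nA; set P := [set a in A | _].
have [->|[a1 aP]] := set_0Vmem P; first by rewrite cards0.
move: (aP); rewrite inE => /andP[a1A g1].
have cA1 : #|A :\ a1| = m.+1 by have := cardsD1 a1 A; rewrite a1A cA => -[].
have inj : {in A :\ a1 &, injective c}.
  by apply/imset_injP; rewrite (eqP g1) cA1 cardsC1 card_ord.
have ci0 : c a1 != i0.
  apply: contra nA => /eqP ca; apply/eqP/setP => i; rewrite inE.
  have [->|ii] := eqVneq i i0; first by rewrite -ca imset_f.
  have : i \in c @: (A :\ a1) by rewrite (eqP g1) !inE.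
  by case/imsetP => b; rewrite inE => /andP[_ bA] ->; rewrite imset_f.
have [a2 a2A ca] : exists2 a2, a2 \in A :\ a1 & c a1 = c a2.
  by apply/imsetP; rewrite (eqP g1) !inE.
have a21 : a2 != a1 by move: a2A; rewrite in_setD1 => /andP[].
have a2A' : a2 \in A by move: a2A; rewrite in_setD1 => /andP[].
suff -> : P = [set a1; a2] by rewrite cards2 eq_sym a21.
apply/setP => a; rewrite !inE; apply/andP/orP => [[aA ga]|].
  have [->|aa1] := eqVneq a a1; first by left.
  right; have aA1 : a \in A :\ a1 by rewrite !inE aa1.
  have : c a \in c @: (A :\ a) by rewrite (eqP ga) -(eqP g1) imset_f.
  case/imsetP => b; rewrite !inE => /andP[ba bA] cab.
  have [ba1|ba1] := eqVneq b a1; first by rewrite (inj a a2) // cab ba1.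
  by rewrite (inj a b) ?eqxx // in ba; rewrite !inE ba1.
case=> /eqP->; first by rewrite a1A.
split=> //; rewrite /door_colored -(eqP g1); apply/eqP/setP => i.
apply/imsetP/imsetP => -[b]; rewrite !inE => /andP[b2 bA] ->.
  have [->|b1] := eqVneq b a1; first by exists a2; rewrite ?ca.
  by exists b; rewrite // !inE b1.
have [->|b1] := eqVneq b a2; first by exists a1; rewrite ?ca // !inE eq_sym a21.
by exists b; rewrite // !inE b1.
Qed.

(** Counting incidences between cells and colored doors in two ways: a cell
    that is not rainbow has an even number of them, and so has every colored door except
    [dummy_door], which lies in a single cell. *)
Theorem scarf : exists A, [/\ dominant A, #|A| = n & c @: A = [set: 'I_n]].
Proof.
have [/existsP[A /andP[/andP[dA /eqP cA] /eqP rA]]|/existsPn no] :=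
    boolP [exists A, cell A && (c @: A == [set: 'I_n])].
  by exists A.
exfalso.
have even : 2 %| \sum_(A | cell A) #|[set a in A | door_colored (A :\ a)]|.
  apply: dvdn_sum => A cA.
  by apply: cell_doors => //; have := no A; rewrite cA.
have E : \sum_(A | cell A) #|[set a in A | door_colored (A :\ a)]|
       = \sum_(B | door_colored B) #|[set x | (x \notin B) && cell (x |: B)]|.
  under eq_bigr do rewrite -sum1_card big_mkcond /=.
  under [RHS]eq_bigr do rewrite -sum1_card big_mkcond /=.
  rewrite exchange_big [RHS]exchange_big; apply: eq_bigr => a _ /=.
  rewrite -!big_mkcondr /= (reindex_onto (fun B => a |: B) (fun A => A :\ a)) /=.
    apply: eq_bigl => B; rewrite !inE eqxx /=.
    have [aB|aB] := boolP (a \in B); last first.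
      by rewrite setU1K // eqxx !andbT andbC.
    rewrite andbF; apply/negbTE; rewrite negb_and; apply/orP; right.
    by apply: contraTneq aB => <-; rewrite !inE eqxx.
  by move=> A /andP[_]; rewrite inE => /andP[aA _]; rewrite setD1K.
have zero B : door_colored B -> ~~ (dominant B && (#|B| == m.+1)) ->
    #|[set x | (x \notin B) && cell (x |: B)]| = 0.
  move=> gB nB; apply: eq_card0 => x; rewrite inE; apply/negP => /and3P[xB dA].
  rewrite cardsU1 xB add1n eqSS => cB; case/negP: nB.
  by rewrite cB andbT (dominantS (subsetUr _ _) dA).
have same B : #|B| = m.+1 -> [set x | (x \notin B) && cell (x |: B)]
    = [set x | (x \notin B) && dominant (x |: B)].
  move=> cB; apply/setP => x; rewrite !inE; have [//|xB] := boolP (x \in B).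
  by rewrite /cell cardsU1 xB cB eqxx andbT.
move: even; rewrite E (bigD1 dummy_door) ?dummy_door_colored //= addnC.
rewrite dvdn_addr; last first.
  apply: dvdn_sum => B /andP[gB nB]; have [/andP[dB /eqP cB]|h] := boolP (dominant B && (#|B| == m.+1)).
    by rewrite same // card_door_cells2.
  by rewrite zero.
by rewrite same ?card_dummy_door // card_dummy_door_cells.
Qed.

End Parity.
End Scarf.

(** * Colorings of grid points of a simplex *)

Section Grid.
Import mathcomp.boot.fintype mathcomp.boot.finset.
Local Open Scope set_scope.
Variables (m N : nat).
Local Notation n := m.+2.

(** The points of the simplex whose coordinates are multiples of [1 / N], scaled
    by [N]. *)
Definition grid := {g : {ffun 'I_n -> 'I_N.+1} | \sum_i (g i : nat) == N}.

Definition coord (a : grid) (i : 'I_n) : nat := sval a i.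

Lemma coord_sum a : \sum_i coord a i = N.
Proof. exact/eqP/(svalP a). Qed.

Lemma coord_le a i : coord a i <= N.
Proof. by rewrite -ltnS ltn_ord. Qed.

Lemma grid_point (f : 'I_n -> nat) : \sum_i f i = N -> exists a, forall i, coord a i = f i.
Proof.
move=> sf; have fN i : f i < N.+1 by rewrite ltnS -sf (bigD1 i) //= leq_addr.
pose g := [ffun i => Ordinal (fN i)]; have sg : \sum_i (g i : nat) == N.
  by rewrite -[X in _ == X]sf; apply/eqP/eq_bigr => i _; rewrite ffunE.
by exists (exist _ g sg) => i; rewrite /coord /= ffunE.
Qed.

(** Points are ranked by a coordinate, with ties broken by an enumeration; the dummy of
    index [i] lies below all points for the order [i] and above them for the
    others, as a point far outside the simplex would. *)
Definition grid_rank (i : 'I_n) (x : grid + 'I_n) : nat :=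
  match x with
  | inl a => (coord a i * #|{: grid}| + enum_rank a).+1
  | inr j => if j == i then 0 else (N.+1 * #|{: grid}| + j).+1
  end.

Lemma grid_rank_lt i a b :
  coord a i < coord b i -> grid_rank i (inl a) < grid_rank i (inl b).
Proof.
move=> lt; rewrite /= ltnS; have ra := ltn_ord (enum_rank a).
apply: (@leq_trans ((coord a i).+1 * #|{: grid}|)).
  by rewrite mulSn addnC ltn_add2r.
by apply: leq_trans (leq_addr _ _); rewrite leq_mul2r lt orbT.
Qed.

Lemma grid_rank_le i a b :
  grid_rank i (inl a) <= grid_rank i (inl b) -> coord a i <= coord b i.
Proof. by apply: contraTT; rewrite -!ltnNge; apply: grid_rank_lt. Qed.

Lemma grid_rank_dummy i j a : i != j -> grid_rank i (inl a) < grid_rank i (inr j).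
Proof.
move=> ij; rewrite /= eq_sym (negPf ij) ltnS; have ra := ltn_ord (enum_rank a).
apply: leq_trans (leq_addr _ _).
apply: (@leq_trans ((coord a i).+1 * #|{: grid}|)).
  by rewrite mulSn addnC ltn_add2r.
by rewrite leq_mul2r ltnS coord_le orbT.
Qed.

Lemma grid_rank_inj i : injective (grid_rank i).
Proof.
have D a j : grid_rank i (inl a) <> grid_rank i (inr j).
  have [<-|ij] := eqVneq i j; first by rewrite /= eqxx.
  by move=> e; have := grid_rank_dummy a ij; rewrite e ltnn.
move=> [a|j] [b|k]; [|by move/D|by move/esym/D|].
- move=> /= [e]; congr inl; apply: enum_rank_inj; apply: ord_inj.
  have := congr1 (modn^~ #|{: grid}|) e; rewrite !modnMDl !modn_small //; exact: ltn_ord.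
- rewrite /=; case: (j =P i) => [->|_]; case: (k =P i) => [->|_] //.
  by move=> /eq_add_S /addnI /ord_inj ->.
Qed.

(** A rainbow dominant set [A] is a small cluster of grid points that carries all
    colors except those of its dummies.  Let [mu i] be the least [i]-th
    coordinate of its points, or 0 when [inr i] is in [A].  If the numbers
    [(mu i).+1] for the other [i] had a sum of at most [N], a grid point would
    exceed [mu i] in all these coordinates, against dominance.  So the [mu i] nearly sum
    up to [N] and determine the points of [A] up to [n]. *)
Lemma grid_coloring (c : grid -> 'I_n) :
  exists a0, forall i, coord a0 i < n \/
    exists2 a, c a = i & forall k, coord a k < coord a0 k + n /\ coord a0 k < coord a k + n.
Proof.
have [x0 _] : exists a : grid, forall i, coord a i = if i == ord0 then N else 0.
  by apply: grid_point; rewrite (bigD1 ord0) //= big1 ?addn0 // => i /negPf ->.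
pose c' (x : grid + 'I_n) := match x with inl a => c a | inr j => j end.
have [||x|//|A [dA cA rA]] :=
  @scarf m (grid + 'I_n)%type grid_rank inr c' (inl x0) grid_rank_inj _ _ _ _ ord0.
- move=> i [a|j] // ij; first by rewrite /= eqxx.
  by rewrite /= eqxx; case: (j =P i) ij => [->|]; rewrite ?eqxx.
- move=> i j [a|k] ij h; first exact: grid_rank_dummy.
  by have := h k; rewrite eqxx.
- by [].
have dom x : exists2 i, inr i \notin A & forall a, inl a \in A -> coord x i <= coord a i.
  have /dominantP/(_ (inl x))[i hi] := dA; exists i.
    by apply/negP => /hi; rewrite /= eqxx.
  by move=> a /hi/grid_rank_le.
have col i : inr i \notin A -> exists2 a, inl a \in A & c a = i.
  move=> iA; have : i \in c' @: A by rewrite rA inE.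
  case/imsetP => -[a aA ->|j jA e]; first by exists a.
  by move: iA; rewrite e jA.
have [a0 a0A] : exists a0, inl a0 \in A.
  by have [i /col[a aA _] _] := dom x0; exists a.
pose lo i := coord [arg min_(a < a0 | inl a \in A) coord a i] i.
have [loA lomin] : (forall i, exists2 a, inl a \in A & coord a i = lo i) /\
    forall i a, inl a \in A -> lo i <= coord a i.
  split=> i; rewrite /lo; case: arg_minnP => // a aA _.
  by exists a.
pose mu i := if inr i \in A then 0 else lo i.
have bound : N < \sum_(i | inr i \notin A) (mu i).+1.
  rewrite ltnNge; apply/negP => le; set s := \sum_(i | _) _ in le.
  have [|x xE] := @grid_point (fun i =>
      (if inr i \notin A then (mu i).+1 else 0) + (if i == ord0 then N - s else 0)).
    rewrite big_split /= -!big_mkcond /= big_pred1_eq -/s; lia.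
  have [i iA h] := dom x; have [a aA e] := loA i; have := h a aA.
  by rewrite e xE iA /mu (negPf iA); lia.
have near a : inl a \in A -> forall k, mu k <= coord a k /\ coord a k < mu k + n.
  move=> aA; have le k : mu k <= coord a k by rewrite /mu; case: ifP => // _; apply: lomin.
  move=> k; split => //.
  have e1 := coord_sum a; rewrite (bigD1 k) //= in e1.
  have e2 : \sum_(i | i != k) mu i <= \sum_(i | i != k) coord a i by apply: leq_sum.
  have e3 : \sum_(i | inr i \notin A) (mu i).+1 <= mu k + \sum_(i | i != k) mu i + n.
    have <- : \sum_i mu i = mu k + \sum_(i | i != k) mu i by rewrite (bigD1 k).
    under eq_bigr do rewrite -addn1.
    rewrite big_split /= sum1_card; apply: leq_add; last first.
      by rewrite -[X in _ <= X]card_ord max_card.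
    by rewrite [X in _ <= X](bigID (fun i => inr i \notin A)) /= leq_addr.
  have := leq_trans (leq_trans bound e3) (leq_add (leq_add (leqnn _) e2) (leqnn n)).
  by rewrite -[X in X < _]e1 addnAC ltn_add2r.
exists a0 => i; have [iA|iA] := boolP (inr i \in A).
  by left; have [_] := near _ a0A i; rewrite /mu iA add0n.
right; have [a aA ca] := col i iA; exists a => // k.
by have := near _ aA k; have := near _ a0A k; lia.
Qed.

End Grid.

(** * Brouwer's fixed point theorem for a simplex *)

Section Brouwer.
Local Open Scope classical_set_scope.
Local Open Scope ring_scope.
Variable R : realType.

Definition std_simplex r : set 'rV[R]_r :=
  @realization R r (powerset [set: 'I_r]%SET).

Lemma std_simplexP r (x : 'rV[R]_r) :
  std_simplex x <-> (forall i, 0 <= x ord0 i) /\ \sum_i x ord0 i = 1.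
Proof.
by split=> [[]//|[x0 x1]]; split => //; rewrite inE finset.subsetT.
Qed.

Lemma std_simplex_le1 r (x : 'rV[R]_r) i : std_simplex x -> x ord0 i <= 1.
Proof.
move=> /std_simplexP[x0 <-]; rewrite (bigD1 i) //= lerDl.
by apply: sumr_ge0.
Qed.

Lemma within_eps r s (A : set 'rV[R]_r) (f : 'rV[R]_r -> 'rV[R]_s) p (e : R) :
  {within A, continuous f} -> A p -> 0 < e ->
  exists2 d : R, 0 < d & forall y, A y -> (forall i, `|p ord0 i - y ord0 i| < d) ->
    forall i, `|f p ord0 i - f y ord0 i| < e.
Proof.
move=> /subspace_continuousP cf Ap e0.
have /nbhs_ballP[d /= d0 hd] : nbhs p [set y | A y -> ball (f p) e (f y)].
  exact: (cf p Ap _ (nbhsx_ballx (f p) _ e0)).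
exists d => // y Ay py i.
have : ball p d y by split => // a b; rewrite [a]ord1; exact: py.
by move=> /hd/(_ Ay)[_ /(_ ord0 i)].
Qed.

Lemma cluster_eps r (x : nat -> 'rV[R]_r) :
  (forall N i, 0 <= x N ord0 i <= 1) ->
  exists p : 'rV[R]_r, (forall i, 0 <= p ord0 i) /\
    forall (e : R) N0, 0 < e -> exists2 N, (N0 <= N)%N & forall i, `|p ord0 i - x N ord0 i| < e.
Proof.
move=> x01.
have cC : compact [set v : 'rV[R]_r | forall i, v ord0 i \in `[0, 1]].
  exact: (@rV_compact R r (fun=> `[0 : R, 1]%classic) (fun=> @segment_compact R 0 1)).
have [|p [p01 cp]] := cC (x @ \oo) _.
  by exists 0%N => // N _ /= i; rewrite in_itv /= x01.
exists p; split=> [i|e N0 e0]; first by have := p01 i; rewrite /= in_itv /= => /andP[].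
have [|_ [[N N0N <-] [_ pN]]] := cp [set x N | N in [set N | (N0 <= N)%N]] _ _ (nbhsx_ballx p _ e0).
  by exists N0 => // N /= N0N; exists N.
by exists N => // i; apply: pN.
Qed.

Lemma sum_eq_le r (x y : 'rV[R]_r) :
  \sum_i x ord0 i = \sum_i y ord0 i -> (forall i, x ord0 i <= y ord0 i) -> y = x.
Proof.
move=> e le; apply/rowP => i; apply/eqP; rewrite -subr_eq0; apply/eqP.
have := @psumr_eq0P R 'I_r xpredT (fun i => y ord0 i - x ord0 i).
apply=> // [j _|]; first by rewrite subr_ge0.
by rewrite sumrB e subrr.
Qed.

Section Approximation.
Variables (m : nat) (f : 'rV[R]_m.+2 -> 'rV[R]_m.+2).
Hypothesis f_simplex : forall x, std_simplex x -> std_simplex (f x).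
Local Notation n := m.+2.

(** A grid point is colored by a coordinate that [f] does not decrease; one
    exists because the coordinates of both points have sum 1. *)
Lemma approximate_fixed_point N : exists x, std_simplex x /\
  forall i, x ord0 i <= n%:R / N.+1%:R \/
    exists2 y, std_simplex y & y ord0 i <= f y ord0 i /\
      forall k, `|x ord0 k - y ord0 k| <= n%:R / N.+1%:R.
Proof.
have N0 : 0 < N.+1%:R :> R by rewrite ltr0n.
pose pt (a : grid m N.+1) : 'rV[R]_n := \row_i ((coord a i)%:R / N.+1%:R).
have ptS a : std_simplex (pt a).
  apply/std_simplexP; split=> [i|]; first by rewrite mxE divr_ge0 ?ler0n.
  under eq_bigr do rewrite mxE.
  by rewrite -mulr_suml -natr_sum coord_sum divff // gt_eqF.
pose c a := odflt ord0 [pick i | pt a ord0 i <= f (pt a) ord0 i].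
have cP a : pt a ord0 (c a) <= f (pt a) ord0 (c a).
  rewrite /c; case: pickP => //= h.
  have /std_simplexP[_ s1] := ptS a; have /std_simplexP[_ s2] := f_simplex (ptS a).
  suff : \sum_i f (pt a) ord0 i < \sum_i pt a ord0 i by rewrite s1 s2 ltxx.
  apply: ltr_sum => [|i _]; last by rewrite ltNge h.
  by apply/hasP; exists ord0; rewrite ?mem_index_enum.
have [a0 ha] := grid_coloring c; exists (pt a0); split=> // i.
have [lt|[a ca near]] := ha i.
  by left; rewrite mxE ler_pM2r ?invr_gt0 // ler_nat ltnW.
right; exists (pt a) => //; rewrite -{1 2}ca; split => // k.
rewrite !mxE -mulrBl normrM [X in _ * X]ger0_norm ?invr_ge0 ?ler0n //.
rewrite ler_pM2r ?invr_gt0 //.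
have [h1 h2] := near k.
have g1 : (coord a k)%:R <= (coord a0 k)%:R + n%:R :> R by rewrite -natrD ler_nat ltnW.
have g2 : (coord a0 k)%:R <= (coord a k)%:R + n%:R :> R by rewrite -natrD ler_nat ltnW.
by rewrite ler_norml; apply/andP; split; lra.
Qed.

End Approximation.

(** At a cluster point of the approximations [f] decreases no coordinate, by
    continuity; as the sums of the coordinates agree, the point is fixed. *)
Theorem brouwer_simplex r (f : 'rV[R]_r -> 'rV[R]_r) : (0 < r)%N ->
  {within @std_simplex r, continuous f} ->
  (forall x, std_simplex x -> std_simplex (f x)) ->
  exists2 x, std_simplex x & f x = x.
Proof.
case: r f => // -[|m] f _ cf fS.
  have s1 : std_simplex (const_mx 1 : 'rV[R]_1).
    by apply/std_simplexP; split => [i|]; rewrite ?big_ord1 mxE.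
  exists (const_mx 1) => //; have /std_simplexP[_] := fS _ s1.
  by rewrite big_ord1 => e; apply/rowP => i; rewrite [i]ord1 e mxE.
have [x xP] := choice (approximate_fixed_point fS).
have xS N : std_simplex (x N) by have [] := xP N.
have [|p [p0 pcl]] := @cluster_eps _ x.
  move=> N i; rewrite std_simplex_le1 // andbT.
  by have /std_simplexP[] := xS N.
have pS : std_simplex p.
  apply/std_simplexP; split => //; apply/eqP; rewrite -subr_eq0 -normr_eq0.
  apply/negPn/negP; rewrite -normr_gt0 normr_id => e0.
  have [|N _ hN] := pcl (`|\sum_i p ord0 i - 1| / m.+2%:R) 0%N.
    by rewrite divr_gt0 // ltr0n.
  have : `|\sum_i p ord0 i - 1| < `|\sum_i p ord0 i - 1|.
    have /std_simplexP[_ s1] := xS N; rewrite -{1}s1 -sumrB.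
    apply: le_lt_trans (ler_norm_sum _ _ _) _.
    rewrite -[X in _ < X](divfK (_ : m.+2%:R != 0)) ?pnatr_eq0 // mulr_natr.
    rewrite -[X in _ *+ X](card_ord m.+2) -sumr_const.
    apply: ltr_sum => [|i _]; last exact: hN.
    by apply/hasP; exists ord0; rewrite ?mem_index_enum.
  by rewrite ltxx.
exists p => //; apply: sum_eq_le => [|i].
  have /std_simplexP[_ ->] := pS; have /std_simplexP[_ ->] //:= fS _ pS.
rewrite leNgt; apply/negP => lt.
have pi0 : 0 < p ord0 i by apply: le_lt_trans lt; have /std_simplexP[] := fS _ pS.
have [|d d0 hd] := within_eps (e := (p ord0 i - f p ord0 i) / 2) cf pS.
  by rewrite divr_gt0 // subr_gt0.
have [e [e0 e1 e2 e3]] : exists e : R, [/\ 0 < e, e + e <= d, e + e <= p ord0 i &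
    e + e <= (p ord0 i - f p ord0 i) / 2].
  set b := Num.min d (Num.min (p ord0 i) ((p ord0 i - f p ord0 i) / 2)).
  exists (b / 2); have -> : b / 2 + b / 2 = b by lra.
  by rewrite divr_gt0 ?lt_min ?d0 ?pi0 ?divr_gt0 ?subr_gt0 // !ge_min !lexx !orbT.
pose N0 := Num.truncn (m.+2%:R / e).
have [N N0N hN] := pcl e N0 e0.
have small : m.+2%:R / N.+1%:R < e.
  rewrite ltr_pdivrMr ?ltr0n // mulrC -ltr_pdivrMr //.
  by apply: lt_le_trans (truncnS_gt _) _; rewrite ler_nat ltnS.
have [_ /(_ i)[le|[y yS [yf hy]]]] := xP N.
  have xe := le_lt_trans le small.
  by have := hN i; rewrite ltr_norml => /andP[_]; clear -xe e2; lra.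
have py k : `|p ord0 k - y ord0 k| < d.
  apply: lt_le_trans e1; rewrite -[p ord0 k](subrK (x N ord0 k)) -addrA.
  by apply: le_lt_trans (ler_normD _ _) _; apply: ltrD; [exact: hN|apply: le_lt_trans small].
have := hd y yS py i; have pyi : `|p ord0 i - y ord0 i| < e + e.
  rewrite -[p ord0 i](subrK (x N ord0 i)) -addrA.
  by apply: le_lt_trans (ler_normD _ _) _; apply: ltrD; [exact: hN|apply: le_lt_trans small].
move: pyi; rewrite !ltr_norml => /andP[h1 h2] /andP[h3 h4]; lra.
Qed.

End Brouwer.

(** * Fixed points on realizations *)

Section FixedPoints.
Local Open Scope classical_set_scope.
Local Open Scope ring_scope.
Variable R : realType.

Lemma within_comp (T U Z : topologicalType) (A : set T) (B : set U)
    (f : T -> U) (g : U -> Z) :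
  {within A, continuous f} -> (forall x, A x -> B (f x)) ->
  {within B, continuous g} -> {within A, continuous (g \o f)}.
Proof.
move=> /subspace_continuousP cf AB /subspace_continuousP cg.
apply/subspace_continuousP => x Ax P /(cg _ (AB x Ax)) hP.
have H : nbhs x [set y | A y -> B (f y) -> P (g (f y))] := cf x Ax _ hP.
change (nbhs x [set y | A y -> P (g (f y))]).
by apply: filterS H => y hy Ay; apply: hy => //; apply: AB.
Qed.

Definition fixed_point_property r (K : set 'rV[R]_r) :=
  forall h : 'rV[R]_r -> 'rV[R]_r, {within K, continuous h} ->
    (forall x, K x -> K (h x)) -> exists2 x, K x & h x = x.

Lemma retract_fixed_point r (K L : set 'rV[R]_r) (rho : 'rV[R]_r -> 'rV[R]_r) :
  continuous rho -> L `<=` K -> (forall x, K x -> L (rho x)) ->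
  (forall x, L x -> rho x = x) ->
  fixed_point_property K -> fixed_point_property L.
Proof.
move=> crho LK KL Lid fK h ch hL.
have [||x Kx hx] := fK (h \o rho).
- apply: within_comp ch; last exact: KL.
  exact: continuous_subspaceT.
- by move=> x Kx; apply/LK/hL/KL.
have Lx : L x by rewrite -hx; apply/hL/KL.
by exists x => //; rewrite -[in RHS]hx /= Lid.
Qed.

(** The antipodal map, transported to the realization, moves every point. *)
Lemma spherical_no_fixed_point r (D : {set {set 'I_r}}) :
  spherical R D -> ~ fixed_point_property (@realization R r D).
Proof.
case=> n [f [g [cf cg fg gf]]] fp.
have anti x : @unit_sphere R n x -> @unit_sphere R n (- x).
  by rewrite /unit_sphere /= => <-; apply: eq_bigr => i _; rewrite mxE sqrrN.
have [||x Dx hx] := fp (g \o (-%R \o f)).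
- apply: (within_comp (B := @unit_sphere R n)) cg.
    apply: (within_comp (B := setT)) cf _ _ => //.
    by apply: continuous_subspaceT; apply: opp_continuous.
  by move=> x /fg[fx _]; apply: anti.
- by move=> x /fg[/anti/gf[]].
have [fx _] := fg x Dx; have [_ e] := gf _ (anti _ fx).
have f0 : f x = 0.
  have : - f x = f x by rewrite -[LHS]e; congr f.
  by move=> /rowP h; apply/rowP => i; have := h i; rewrite !mxE; lra.
move: fx; rewrite /unit_sphere /= f0 big1 => [|i _]; last by rewrite mxE expr0n.
by move/eqP; rewrite eq_sym oner_eq0.
Qed.

Lemma continuous_bigmin r (P : pred 'I_r) (l : seq 'I_r) :
  continuous (fun x : 'rV[R]_r => \big[Num.min/1]_(i <- l | P i) x ord0 i).
Proof.
elim: l => [|i l IH].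
  rewrite (_ : (fun _ => _) = fun=> 1); first exact: cst_continuous.
  by apply/funext => x; rewrite big_nil.
have [Pi|Pi] := boolP (P i); last first.
  rewrite (_ : (fun _ => _) = fun x : 'rV[R]_r => \big[Num.min/1]_(i <- l | P i) x ord0 i) //.
  by apply/funext => x; rewrite big_cons (negPf Pi).
rewrite (_ : (fun _ => _) = (fun x : 'rV[R]_r => x ord0 i) \min
    (fun x : 'rV[R]_r => \big[Num.min/1]_(i <- l | P i) x ord0 i)).
  by move=> x; apply: continuous_min; [exact: coord_continuous|exact: IH].
by apply/funext => x; rewrite big_cons Pi.
Qed.

Definition support r (x : 'rV[R]_r) : {set 'I_r} := [set i | x ord0 i != 0]%SET.

Section Retraction.
Import mathcomp.boot.fintype mathcomp.boot.finset.
Variables (r : nat) (F : {set 'I_r}) (u : 'I_r).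
Hypotheses (uF : u \notin F) (F0 : F != set0).

(* The value 1 bounds all coordinates of points of the simplex, so the minimum
   is attained on [F]. *)
Definition push_min (x : 'rV[R]_r) : R := \big[Num.min/1]_(i in F) x ord0 i.

Definition push_dir : 'rV[R]_r :=
  \row_i (if i == u then #|F|%:R else if i \in F then -1 else 0).

(** Points of the removed faces are moved away from the vertices of the free
    face [F], towards [u], until they lose one of these vertices. *)
Definition push (x : 'rV[R]_r) := x + push_min x *: push_dir.

Lemma push_continuous : continuous push.
Proof.
move=> x; apply: (@cvgD R 'rV[R]_r _ (nbhs x) _ id (fun y => push_min y *: push_dir)).
  exact: cvg_id.
by apply: cvgZr_tmp; apply: continuous_bigmin.
Qed.

Lemma push_minP x : std_simplex x ->
  [/\ 0 <= push_min x, forall i, i \in F -> push_min x <= x ord0 i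
    & exists2 i, i \in F & push_min x = x ord0 i].
Proof.
move=> xS; have /std_simplexP[x0 _] := xS.
have [i0 iF] := set0Pn _ F0.
have [|j jF e] := @eq_bigmin _ _ _ 1 i0 [in F] (fun i => x ord0 i) iF.
  by move=> i _; apply: std_simplex_le1.
split; last by exists j.
  by rewrite /push_min e.
by move=> i iF'; apply: bigmin_le_cond.
Qed.

Lemma push_id x : std_simplex x -> ~~ (F \subset support x) -> push x = x.
Proof.
move=> /push_minP[m0 mle _] /subsetPn[i iF]; rewrite inE negbK => /eqP xi.
have : push_min x <= 0 by rewrite -xi mle.
move=> le; have e : push_min x = 0 by apply/le_anti; rewrite le m0.
by rewrite /push e scale0r addr0.
Qed.

Lemma push_simplex x : std_simplex x -> std_simplex (push x).
Proof.
move=> xS; have /std_simplexP[x0 x1] := xS; have [m0 mle _] := push_minP xS.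
apply/std_simplexP; split=> [i|].
  rewrite !mxE; case: ifP => _; first by rewrite addr_ge0 ?mulr_ge0.
  case: ifP => iF; last by rewrite mulr0 addr0.
  by rewrite mulrN1 subr_ge0 mle.
under eq_bigr do rewrite !mxE.
rewrite big_split /= x1 -mulr_sumr (bigD1 u) //= eqxx.
rewrite (eq_bigr (fun i => if i \in F then -1 else 0)); last by move=> i /negPf ->.
rewrite -big_mkcondr /= (eq_bigl [in F]); last first.
  by move=> i; rewrite andb_idl // => iF; apply: contraNneq uF => <-.
by rewrite sumr_const mulNrn subrr mulr0 addr0.
Qed.

(** A vertex of [F] with the smallest coordinate leaves the support. *)
Lemma push_support x : std_simplex x -> support x \subset u |: F ->
  support (push x) \subset u |: F /\ ~~ (F \subset support (push x)).
Proof.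
move=> xS sx; have [_ _ [i iF e]] := push_minP xS; split.
  apply/subsetP => j; rewrite !inE !mxE.
  have [//|ju] := boolP (j == u); have [//|jF] := boolP (j \in F).
  rewrite mulr0 addr0 => xj; have := subsetP sx j.
  by rewrite !inE xj (negPf ju) (negPf jF) => /(_ isT).
apply/subsetPn; exists i => //; rewrite inE negbK !mxE iF e.
have /negPf -> : i != u by apply: contraNneq uF => <-.
by rewrite mulrN1 subrr.
Qed.

End Retraction.

Import mathcomp.boot.fintype mathcomp.boot.finset.

Lemma realizationP r (D : {set {set 'I_r}}) (x : 'rV[R]_r) :
  realization D x <-> std_simplex x /\ support x \in D.
Proof.
split=> [[x0 x1 xD]|[/std_simplexP[x0 x1] xD]]; last by [].
by split => //; apply/std_simplexP.
Qed.

Lemma collapse_fixed_point r (D D1 : {set {set 'I_r}}) :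
  down_closed D -> set0 \in D1 -> elementary_collapse D D1 ->
  fixed_point_property (@realization R r D) ->
  fixed_point_property (@realization R r D1).
Proof.
move=> cD D10 [F [u [uF FD uFD max D1E]]].
have F0 : F != set0.
  by apply: contraTneq D10 => F0; rewrite D1E F0 !inE eqxx.
have D1D : D1 \subset D by rewrite D1E subsetDl.
have inD1 G : G \in D -> ~~ (F \subset G) -> G \in D1.
  move=> GD nF; rewrite D1E in_setD GD andbT in_set2 negb_or.
  by apply/andP; split; apply: contraNneq nF => ->; rewrite ?subsetUr.
have nFD1 G : G \in D1 -> ~~ (F \subset G).
  rewrite D1E in_setD in_set2 negb_or => /andP[/andP[/eqP n1 /eqP n2] GD].
  by apply/negP => /(max G GD)[].
apply: (retract_fixed_point (rho := push F u)).
- exact: push_continuous.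
- move=> x /realizationP[xS xD]; apply/realizationP; split => //.
  exact: (subsetP D1D).
- move=> x /realizationP[xS xD]; apply/realizationP; split.
    exact: push_simplex.
  have [Fx|nFx] := boolP (F \subset support x); last first.
    by rewrite push_id //; apply: inD1.
  have sx : support x \subset u |: F.
    by case: (max _ xD Fx) => ->; rewrite ?subsetUr.
  have [s1 s2] := push_support uF F0 xS sx.
  by apply: inD1 => //; apply: cD s1.
by move=> x /realizationP[xS xD]; apply: push_id => //; apply: nFD1.
Qed.

Lemma collapses_fixed_point r (D D0 : {set {set 'I_r}}) :
  collapses D0 D -> down_closed D -> set0 \in D0 ->
  fixed_point_property (@realization R r D) ->
  fixed_point_property (@realization R r D0).
Proof.
move=> c; elim: c => // {}D D1 e c IH cD D00 fD.
have D10 : set0 \in D1 by apply: (subsetP (collapses_sub c)).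
apply: IH => //; last exact: collapse_fixed_point e fD.
case: e => F [u [uF FD uFD max ->]] J K; rewrite !in_setD !in_set2 !negb_or.
move=> /andP[/andP[/eqP n1 /eqP n2] KD] JK; rewrite (cD _ _ KD JK) andbT.
have nF : ~~ (F \subset K) by apply/negP => /(max K KD)[].
by apply/andP; split; apply: contraNneq nF => JE; apply: subset_trans JK;
  rewrite JE ?subsetUr.
Qed.

End FixedPoints.

Lemma star_closed (V : finType) (D : {set {set V}}) (I : {set V}) :
  down_closed D -> down_closed (star D I).
Proof.
move=> cD J K; rewrite !inE => /andP[KD IK] JK; rewrite (cD J K KD JK) /=.
by apply: (cD _ _ IK); apply: finset.setUS.
Qed.

(** * Strong vertex decomposability of spherical subword complexes *)

Lemma subword_complexE (W : finGroupType) (S : {set W}) (hS : coxeter_system S)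
    (r : nat) (Q : r.-tuple W) (w : W) :
  subword_complex S Q w = cplx hS (tnth Q) (enum 'I_r) w.
Proof.
apply/setP => I; rewrite [LHS]inE [RHS]inE; apply: eq_existsb => F.
have -> : F \subset enum 'I_r by apply/fintype.subsetP => i; rewrite mem_enum.
rewrite reduced_expressionE; congr (_ && reduced _ _ _).
rewrite /subword /word; congr map; rewrite enumT.
by apply: eq_filter => i; rewrite !inE.
Qed.

Theorem theorem4p5 (R : realType) (W : finGroupType) (S : {set W})
    (hS : coxeter_system S) (r : nat) (Q : r.-tuple W) (hQ : word_in S Q)
    (w : W) (hsph : spherical R (subword_complex S Q w)) :
  strongly_vertex_decomposable (subword_complex S Q w) /\
  strongly_shellable (subword_complex S Q w).
Proof.
rewrite (subword_complexE hS) in hsph *.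
set p := enum 'I_r in hsph *; set D := cplx _ _ _ _ in hsph *.
have up : uniq p by apply: enum_uniq.
have Sp : labelled S (tnth Q) p by move=> i _; apply: (allP hQ); apply: mem_tnth.
have cD : down_closed D by apply: cplx_closed.
suff svd : strongly_vertex_decomposable D.
  split => // I ID; have [vc vs] := svd I ID; split; apply: vd_shellable => //.
    exact: costar_closed.
  exact: star_closed.
move=> I ID; split; last exact: star_cplx_vd.
apply: costar_dem_vd => //; apply/eqP/negPn/negP => dw.
have D0 : finset.set0 \in D by apply: cD ID (finset.sub0set _).
have p0 : p != [::].
  apply: contraNneq dw => pE; move: ID => /cplxP[F [_ _]].
  by rewrite pE => /reducedP[_ <- _]; rewrite word_prod_nil.
have r0 : (0 < r)%N by rewrite -(size_enum_ord r) lt0n size_eq0.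
apply: (spherical_no_fixed_point hsph).
apply: (collapses_fixed_point (cplx_collapses up Sp p0 dw)) => //.
  by move=> J K; rewrite !inE => KX JK; apply: fintype.subset_trans KX.
have -> : [set x in p]%SET = [set: 'I_r]%SET.
  by apply/setP => x; rewrite !inE mem_enum.
by move=> h ch hS'; apply: brouwer_simplex.
Qed.
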